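(* Let $\alpha>1$, $k\ge 2$ an integer, $f\in\mathcal{M}_{\alpha,k}$, let $\phi:\mathbb{N}\to\mathbb{C}$ be an arithmetic function such that the Dirichlet series $\Phi(s)=\sum_{n=1}^\infty \phi(n)n^{-s}$ converges absolutely in the half-plane $\operatorname{Re}(s)>1$. Then for every $1<\sigma<\alpha$, $\Phi(s)f^*(s)\in L_1(\sigma-i\infty,\sigma+i\infty)$ and for all $x>0$ $$\frac{1}{2\pi i}\int_{\sigma-i\infty}^{\sigma+i\infty}\Phi(s)f^*(s)x^{-s}\,ds=\sum_{n=1}^\infty\phi(n)f(nx);$$ moreover the Mellin transform of $x\mapsto\sum_{n=1}^\infty\phi(n)f(nx)$ exists in the strip $1<\operatorname{Re}(s)<\alpha$ and equals $\Phi(s)f^*(s)$ there.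
   Context: For $\alpha>1$ and $k\in\mathbb{N}_0$, the class $\mathcal{M}_{\alpha,k}$ consists of the functions $f$ defined on $[0,\infty)$ such that $f\in\mathcal{C}^{(k)}([0,\infty))$ and $f^{(j)}(x)=\mathcal{O}(x^{-\alpha-j})$ as $x\to\infty$, for all $j=0,1,\dots,k$. $f^*(s)=\int_0^\infty f(x)x^{s-1}dx$ denotes the Mellin transform of $f$. *)

(* Defs.v *)
From Stdlib Require Import Reals.
From Coquelicot Require Import Coquelicot.

Open Scope R_scope.

Definition CR : CompleteNormedModule R_AbsRing := C_R_CompleteNormedModule.

Definition is_CInt_gen (f : R -> C) (F G : (R -> Prop) -> Prop) (l : C) : Prop :=
  @is_RInt_gen CR f F G l.
Definition CInt_gen (f : R -> C) (F G : (R -> Prop) -> Prop) : C :=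
  @RInt_gen CR f F G.

(* Sum of a complex series (meaningful when it converges). *)
Definition CSeries (a : nat -> C) : C :=
  (Series (fun n => Re (a n)), Series (fun n => Im (a n))).

(* x^s = exp(s log x) for real x > 0 and complex s. *)
Definition cpow (x : R) (s : C) : C :=
  (Rpower x (Re s) * cos (Im s * ln x), Rpower x (Re s) * sin (Im s * ln x)).

Definition mellin (f : R -> C) (s : C) : C :=
  CInt_gen (fun x => (f x * cpow x (s - 1))%C) (at_right 0) (Rbar_locally p_infty).

Definition cont_on_nonneg (g : R -> C) : Prop :=
  forall x, 0 <= x ->
    filterlim g (within (fun y => 0 <= y) (locally x)) (locally (g x)).

Definition deriv_on_nonneg (g g' : R -> C) : Prop :=
  forall x, 0 <= x ->
    filterlim (fun y => ((g y - g x) / RtoC (y - x))%C)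
      (within (fun y => 0 <= y /\ y <> x) (locally x)) (locally (g' x)).

Definition class_M (alpha : R) (k : nat) (f : R -> C) : Prop :=
  exists D : nat -> R -> C,
    (forall x, 0 <= x -> D O x = f x) /\
    (forall j, (j <= k)%nat -> cont_on_nonneg (D j)) /\
    (forall j, (j < k)%nat -> deriv_on_nonneg (D j) (D (S j))) /\
    (forall j, (j <= k)%nat -> exists c M, 0 < M /\
       forall x, M <= x -> Cmod (D j x) <= c * Rpower x (- alpha - INR j)).

(* n-th term (n >= 1, shifted to index n-1) of the Dirichlet series *)
Definition dterm (phi : nat -> C) (s : C) (n : nat) : C :=
  (phi (S n) * cpow (INR (S n)) (- s))%C.

Definition Dirichlet (phi : nat -> C) (s : C) : C := CSeries (dterm phi s).

Definition phisum (phi : nat -> C) (f : R -> C) (x : R) : C :=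
  CSeries (fun n => (phi (S n) * f (INR (S n) * x)%R)%C).

(* Main.v *)
Require Import Defs.
From Stdlib Require Import Reals Lra Lia.
From Coquelicot Require Import Coquelicot.

(** The substitution [x = exp u] turns the Mellin transform on the line [Re s = sigma] into the
    Fourier transform [F] of [P u = exp (sigma u) f (exp u)], which decays exponentially together
    with its first two derivatives; integrating by parts twice gives [F t = O(1 / (1 + t^2))].
    Fourier inversion is obtained by Abel summation: integrating the cosine transform against
    [exp (- e t)] over [t >= 0] gives the integral of [P] against the kernel [e / (e^2 + u^2)],
    an approximate identity of mass [PI] as [e] tends to 0.  Since [x -> n x] is the translation
    [u -> u + ln n], both identities follow from the single-function case by integrating term by
    term series dominated by [M_n / (1 + u^2)] with summable [M_n]: for the inversion formula
    [M_n] is a multiple of [|phi n| n^(-sigma)], and for the Mellin transform of the sum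
    the translation costs a factor polynomial in [ln n], absorbed by lowering [sigma]
    while staying above 1. *)

Open Scope R_scope.

Local Notation minf := (Rbar_locally m_infty) (only parsing).
Local Notation pinf := (Rbar_locally p_infty) (only parsing).

(** Every exchange of limits rests on an explicit estimate. The single majorant [K / (1 + u ^ 2)]
    makes this possible: its integral is [K * PI] through [atan], its tails are differences of
    [atan], and the transforms fall back into the same class because [f] has two derivatives to
    spend. The obstacle in the inversion is that the double integral of [p u * cos (t * u)] over [t]
    and [u] does not converge absolutely, so the order cannot simply be swapped. Damping removes
    this, and Fubini is replaced by the fundamental theorem of calculus: the damped integral up to
    [T] is compared with an integral over [u] that has the same derivative in [T]. The strict
    inequalities [1 < sigma < alpha] leave room on both sides of [sigma], which turns the bounds of
    the class into exponential decay of [P] at both ends. *)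

Lemma Rcontinuous_mult (f g : R -> R) (x : R) :
  continuous f x -> continuous g x -> continuous (fun y => f y * g y) x.
Proof. intros Hf Hg. exact (continuous_mult f g x Hf Hg). Qed.

Lemma Rcontinuous_plus (f g : R -> R) (x : R) :
  continuous f x -> continuous g x -> continuous (fun y => f y + g y) x.
Proof. intros Hf Hg. exact (continuous_plus f g x Hf Hg). Qed.

Lemma Rcontinuous_minus (f g : R -> R) (x : R) :
  continuous f x -> continuous g x -> continuous (fun y => f y - g y) x.
Proof. intros Hf Hg. exact (continuous_minus f g x Hf Hg). Qed.

Lemma is_derive_Rcontinuous (f : R -> R) (x l : R) : is_derive f x l -> continuous f x.
Proof. intros H. apply (ex_derive_continuous (V := R_NormedModule)). exists l; exact H. Qed.

Lemma continuous_ex_RInt (h : R -> R) (a b : R) : (forall u, continuous h u) -> ex_RInt h a b.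
Proof. intros H. apply (ex_RInt_continuous (V := R_CompleteNormedModule)); auto. Qed.

Lemma continuous_is_RInt (h : R -> R) (a b : R) :
  (forall u, continuous h u) -> is_RInt h a b (RInt h a b).
Proof.
  intros H. apply (RInt_correct (V := R_CompleteNormedModule)), continuous_ex_RInt, H.
Qed.

Ltac cont_by_derive := apply (ex_derive_continuous (V := R_NormedModule)); auto_derive; auto.

(** * Integrals over the line of functions dominated by [K / (1 + u^2)] *)

(** Continuity is part of the class, so every integral over a segment exists and only the ends at
    infinity need an argument. *)
Definition cauchy_dom (K : R) (h : R -> R) : Prop :=
  (forall u, continuous h u) /\ (forall u, Rabs (h u) <= K / (1 + u ^ 2)).

Definition Jint (h : R -> R) : R := RInt_gen h minf pinf.

Lemma one_sq_pos (u : R) : 0 < 1 + u ^ 2.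
Proof. nra. Qed.

Lemma cauchy_dom_nonneg K h : cauchy_dom K h -> 0 <= K.
Proof.
  intros [_ H]. specialize (H 0). pose proof (Rabs_pos (h 0)).
  replace (K / (1 + 0 ^ 2)) with K in H by field. lra.
Qed.

Lemma is_RInt_cauchy K a b : is_RInt (fun u => K / (1 + u ^ 2)) a b (K * atan b - K * atan a).
Proof.
  apply (is_RInt_derive (fun u => K * atan u) (fun u => K / (1 + u ^ 2))).
  - intros x _. pose proof (one_sq_pos x). auto_derive; auto. unfold Rsqr. field. nra.
  - intros x _. pose proof (one_sq_pos x). cont_by_derive. nra.
Qed.

Lemma cauchy_dom_RInt_le K h a b : cauchy_dom K h -> a <= b ->
  Rabs (RInt h a b) <= K * (atan b - atan a).
Proof.
  intros [Hc Hb] Hab. rewrite Rmult_minus_distr_l.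
  apply (norm_RInt_le h (fun u => K / (1 + u ^ 2)) a b); auto.
  - apply continuous_is_RInt, Hc.
  - apply is_RInt_cauchy.
Qed.

Lemma cauchy_dom_RInt_abs K h a b : cauchy_dom K h ->
  Rabs (RInt h a b) <= K * Rabs (atan b - atan a).
Proof.
  intros H. pose proof (cauchy_dom_nonneg K h H) as HK.
  destruct (Rle_lt_dec a b) as [Hab|Hab].
  - eapply Rle_trans; [apply (cauchy_dom_RInt_le K h); auto|].
    apply Rmult_le_compat_l; auto. apply Rle_abs.
  - rewrite <- opp_RInt_swap by apply continuous_ex_RInt, H.
    unfold opp; simpl. rewrite Rabs_Ropp.
    eapply Rle_trans; [apply (cauchy_dom_RInt_le K h); auto; lra|].
    apply Rmult_le_compat_l; auto. rewrite <- Rabs_Ropp, Ropp_minus_distr. apply Rle_abs.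
Qed.

(** For [x > 0], [PI / 2 - atan x] equals [atan (/ x)], which the mean value theorem bounds by
    [/ x]. *)
Lemma is_lim_atan_p : filterlim atan pinf (locally (PI / 2)).
Proof.
  apply filterlim_locally. intros eps. exists (/ eps). intros x Hx.
  pose proof (cond_pos eps) as He. pose proof (Rinv_0_lt_compat _ He) as Hi.
  assert (Hx0 : 0 < x) by lra.
  change (Rabs (atan x - PI / 2) < eps).
  pose proof (atan_bound x). rewrite Rabs_left by lra.
  replace (- (atan x - PI / 2)) with (PI / 2 - atan x) by ring.
  rewrite <- atan_inv by lra.
  assert (Hle : atan (/ x) <= / x).
  { destruct (MVT_gen atan 0 (/ x) (fun u => / (1 + u ^ 2))) as [c [_ Hc]].
    - intros u _. pose proof (is_derive_atan u) as D. unfold Rsqr in D.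
      replace (1 + u ^ 2) with (1 + u * u) by ring. exact D.
    - intros u _. apply continuity_pt_filterlim. apply (is_derive_Rcontinuous _ _ _ (is_derive_atan u)).
    - rewrite atan_0, !Rminus_0_r in Hc. rewrite Hc.
      pose proof (Rinv_0_lt_compat _ Hx0). pose proof (one_sq_pos c).
      rewrite <- (Rmult_1_l (/ x)) at 2. apply Rmult_le_compat_r; [lra|].
      rewrite <- Rinv_1. apply Rinv_le_contravar; nra. }
  eapply Rle_lt_trans; [exact Hle|].
  rewrite <- (Rinv_inv eps). apply Rinv_lt_contravar; auto. nra.
Qed.

Lemma is_lim_atan_m : filterlim atan minf (locally (- (PI / 2))).
Proof.
  apply (filterlim_ext (fun x => - atan (- x))).
  { intros x. rewrite atan_opp. ring. }
  apply (filterlim_comp _ _ _ (fun x => atan (- x)) Ropp minf (locally (PI / 2))).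
  - apply (filterlim_comp _ _ _ Ropp atan minf pinf).
    + exact (filterlim_Rbar_opp m_infty).
    + exact is_lim_atan_p.
  - exact (filterlim_opp (PI / 2)).
Qed.

Lemma ball_Rabs (x y eps : R) : ball x eps y -> Rabs (y - x) < eps.
Proof. exact (fun H => H). Qed.

Lemma Rabs_ball (x y eps : R) : Rabs (y - x) < eps -> ball x eps y.
Proof. exact (fun H => H). Qed.

(** Cauchy criterion: two integrals over segments differ by two end pieces, each at most [K] times a
    variation of [atan], and [atan] converges at both ends. *)
Lemma cauchy_dom_is K h : cauchy_dom K h -> is_RInt_gen h minf pinf (Jint h).
Proof.
  intros H. apply (RInt_gen_correct (V := R_CompleteNormedModule));
    try apply Proper_StrongProper; try apply Rbar_locally_filter.
  pose proof (cauchy_dom_nonneg K h H) as HK.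
  assert (E : exists y : R, filterlim (fun ab : R * R => RInt h (fst ab) (snd ab))
    (filter_prod minf pinf) (locally y)).
  { apply (filterlim_locally_cauchy (U := R_CompleteSpace)). intros eps.
    (* Each of the two end pieces involves two deviations of [atan] from its limit, hence the 4;
       [K + 1] keeps the denominator positive when [K] is 0. *)
    assert (He : 0 < eps / (4 * (K + 1))).
    { apply Rdiv_lt_0_compat; [apply cond_pos|lra]. }
    pose proof (proj1 (filterlim_locally _ _) is_lim_atan_m (mkposreal _ He)) as Hm.
    pose proof (proj1 (filterlim_locally _ _) is_lim_atan_p (mkposreal _ He)) as Hp.
    exists (fun ab => ball (- (PI/2)) (mkposreal _ He) (atan (fst ab)) /\
                ball (PI/2) (mkposreal _ He) (atan (snd ab))). split.
    - apply (Filter_prod minf pinf _ _ _ Hm Hp).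
      intros x y Hx Hy; split; [exact Hx|exact Hy].
    - intros [a b] [a' b'] [Ha Hb] [Ha' Hb']; simpl in *.
      apply ball_Rabs in Ha; apply ball_Rabs in Hb; apply ball_Rabs in Ha'; apply ball_Rabs in Hb'.
      apply Rabs_ball. simpl in *.
      assert (X : RInt h a' b' - RInt h a b = RInt h a' a + RInt h b b').
      { rewrite <- (RInt_Chasles h a' a b'), <- (RInt_Chasles h a b b')
          by (apply continuous_ex_RInt, H).
        unfold plus; simpl. ring. }
      rewrite X.
      pose proof (cauchy_dom_RInt_abs K h a' a H) as B1.
      pose proof (cauchy_dom_RInt_abs K h b b' H) as B2.
      eapply Rle_lt_trans; [apply Rabs_triang|].
      eapply Rle_lt_trans; [apply Rplus_le_compat; [exact B1|exact B2]|].
      assert (E1 : Rabs (atan a - atan a') < 2 * (eps / (4 * (K+1)))).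
      { apply Rabs_def2 in Ha; apply Rabs_def2 in Ha'. apply Rabs_def1; lra. }
      assert (E2 : Rabs (atan b' - atan b) < 2 * (eps / (4 * (K+1)))).
      { apply Rabs_def2 in Hb; apply Rabs_def2 in Hb'. apply Rabs_def1; lra. }
      assert (E3 : (K + 1) * (eps / (4 * (K+1))) = eps / 4) by (field; lra).
      pose proof (Rabs_pos (atan a - atan a')). pose proof (Rabs_pos (atan b' - atan b)).
      pose proof (cond_pos eps).
      nra. }
  destruct E as [y Hy]. exists y.
  intros P HP. specialize (Hy P HP).
  unfold filtermap in Hy. unfold filtermapi.
  apply (filter_imp (F := filter_prod minf pinf)) with (2 := Hy).
  intros ab Hab. exists (RInt h (fst ab) (snd ab)). split; auto.
  apply continuous_is_RInt, H.
Qed.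

Lemma Jint_unique h l : is_RInt_gen h minf pinf l -> Jint h = l.
Proof.
  exact (@is_RInt_gen_unique R_CompleteNormedModule minf pinf
    (Proper_StrongProper _ (Rbar_locally_filter m_infty))
    (Proper_StrongProper _ (Rbar_locally_filter p_infty)) h l).
Qed.

Lemma prod_le_filter : filter_prod minf pinf (fun ab : R * R => fst ab <= snd ab).
Proof.
  apply (Filter_prod minf pinf _ (fun x => x < 0) (fun x => 0 < x)).
  - exists 0; auto.
  - exists 0; auto.
  - simpl; intros; lra.
Qed.

Lemma Jint_abs_le K h K' w : cauchy_dom K h -> cauchy_dom K' w ->
  (forall u, Rabs (h u) <= w u) -> Rabs (Jint h) <= Jint w.
Proof.
  intros H H' Hb.
  apply (RInt_gen_norm (Fa := minf) (Fb := pinf) h w).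
  - apply prod_le_filter.
  - apply filter_forall. intros ab x _. apply Hb.
  - apply (cauchy_dom_is K); auto.
  - apply (cauchy_dom_is K'); auto.
Qed.

Lemma Jint_ext K f g : cauchy_dom K f -> (forall u, f u = g u) -> Jint f = Jint g.
Proof.
  intros H E. symmetry. apply Jint_unique.
  apply (is_RInt_gen_ext f).
  - apply filter_forall. auto.
  - apply (cauchy_dom_is K f H).
Qed.

Lemma Jint_plus K K' f g : cauchy_dom K f -> cauchy_dom K' g ->
  Jint (fun u => f u + g u) = Jint f + Jint g.
Proof.
  intros H H'. apply Jint_unique.
  apply (is_RInt_gen_plus f g); [apply (cauchy_dom_is K)|apply (cauchy_dom_is K')]; auto.
Qed.

Lemma Jint_scal K c f : cauchy_dom K f -> Jint (fun u => c * f u) = c * Jint f.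
Proof.
  intros H. apply Jint_unique.
  apply (is_RInt_gen_scal f c); apply (cauchy_dom_is K); auto.
Qed.

Lemma cauchy_dom_plus K K' f g : cauchy_dom K f -> cauchy_dom K' g ->
  cauchy_dom (K + K') (fun u => f u + g u).
Proof.
  intros [H1 H2] [H3 H4]; split.
  - intros u. apply Rcontinuous_plus; auto.
  - intros u. eapply Rle_trans; [apply Rabs_triang|].
    replace ((K + K') / (1 + u ^ 2)) with (K / (1 + u ^ 2) + K' / (1 + u ^ 2))
      by (field; pose proof (one_sq_pos u); lra).
    apply Rplus_le_compat; auto.
Qed.

Lemma cauchy_dom_mult K L f g : cauchy_dom K f -> (forall u, continuous g u) ->
  (forall u, Rabs (g u) <= L) -> cauchy_dom (L * K) (fun u => g u * f u).
Proof.
  intros [H1 H2] Hg HL; split.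
  - intros u. apply Rcontinuous_mult; auto.
  - intros u. rewrite Rabs_mult. unfold Rdiv. rewrite Rmult_assoc.
    apply Rmult_le_compat; auto using Rabs_pos.
Qed.

Lemma cauchy_dom_scal K c f : cauchy_dom K f -> cauchy_dom (Rabs c * K) (fun u => c * f u).
Proof.
  intros H. apply cauchy_dom_mult; auto.
  - intros u. apply continuous_const.
  - intros; lra.
Qed.

Lemma cauchy_dom_ext K f g : (forall u, f u = g u) -> cauchy_dom K f -> cauchy_dom K g.
Proof.
  intros E [H1 H2]; split; intros u.
  - apply (continuous_ext f); auto.
  - rewrite <- E; auto.
Qed.

Lemma cauchy_dom_weaken K K' f : K <= K' -> cauchy_dom K f -> cauchy_dom K' f.
Proof.
  intros E [H1 H2]; split; auto. intros u. eapply Rle_trans; [apply H2|].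
  unfold Rdiv. apply Rmult_le_compat_r; auto.
  left; apply Rinv_0_lt_compat, one_sq_pos.
Qed.

Lemma Jint_minus K K' f g : cauchy_dom K f -> cauchy_dom K' g ->
  Jint (fun u => f u - g u) = Jint f - Jint g.
Proof.
  intros H H'. apply Jint_unique.
  apply (is_RInt_gen_minus f g); [apply (cauchy_dom_is K)|apply (cauchy_dom_is K')]; auto.
Qed.

Lemma cauchy_dom_minus K K' f g : cauchy_dom K f -> cauchy_dom K' g ->
  cauchy_dom (K + K') (fun u => f u - g u).
Proof.
  intros H H'. apply (cauchy_dom_ext _ (fun u => f u + (-1) * g u)); [intros; ring|].
  apply cauchy_dom_plus; auto. rewrite <- (Rmult_1_l K'), <- Rabs_R1, <- (Rabs_Ropp 1).
  apply cauchy_dom_scal; auto.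
Qed.

Lemma Jint_FTC K h P la lb : cauchy_dom K h -> (forall u, is_derive P u (h u)) ->
  filterlim P minf (locally la) -> filterlim P pinf (locally lb) -> Jint h = lb - la.
Proof.
  intros [Hc Hb] Hd Ha Hlb. apply Jint_unique.
  apply (is_RInt_gen_ext (Derive P)).
  { apply filter_forall. intros ab x _. apply is_derive_unique, Hd. }
  apply is_RInt_gen_Derive; auto.
  - apply filter_forall. intros ab x _. exists (h x); apply Hd.
  - apply filter_forall. intros ab x _. apply (continuous_ext h); auto.
    intros y. symmetry. apply is_derive_unique, Hd.
Qed.

Lemma cauchy_dom_cauchy K : 0 <= K -> cauchy_dom K (fun u => K / (1 + u ^ 2)).
Proof.
  intros HK. split; intros u; pose proof (one_sq_pos u).
  - cont_by_derive. nra.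
  - rewrite Rabs_right; [lra|]. apply Rle_ge, Rdiv_le_0_compat; auto.
Qed.

Lemma Jint_cauchy K : 0 <= K -> Jint (fun u => K / (1 + u ^ 2)) = K * PI.
Proof.
  intros HK.
  rewrite (Jint_FTC K _ (fun u => K * atan u) (K * (- (PI / 2))) (K * (PI / 2))).
  - field.
  - apply cauchy_dom_cauchy; auto.
  - intros u. pose proof (one_sq_pos u). auto_derive; auto. unfold Rsqr. field. nra.
  - apply (filterlim_comp _ _ _ atan (fun y => K * y) minf (locally (- (PI/2)))).
    + apply is_lim_atan_m.
    + exact (filterlim_scal_r K (- (PI / 2))).
  - apply (filterlim_comp _ _ _ atan (fun y => K * y) pinf (locally (PI/2))).
    + apply is_lim_atan_p.
    + exact (filterlim_scal_r K (PI / 2)).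
Qed.

Lemma Jint_bound K h : cauchy_dom K h -> Rabs (Jint h) <= K * PI.
Proof.
  intros H. rewrite <- Jint_cauchy by apply (cauchy_dom_nonneg K h H).
  apply (Jint_abs_le K _ K); auto.
  - apply cauchy_dom_cauchy, (cauchy_dom_nonneg K h H).
  - apply H.
Qed.

Lemma cauchy_dom_lim K P : cauchy_dom K P ->
  filterlim P minf (locally 0) /\ filterlim P pinf (locally 0).
Proof.
  intros [Hc Hb].
  assert (X : forall (eps : posreal) u, K / eps < Rabs u -> 1 < Rabs u -> Rabs (P u - 0) < eps).
  { intros eps u H1 H2. rewrite Rminus_0_r. eapply Rle_lt_trans; [apply Hb|].
    pose proof (cond_pos eps). pose proof (one_sq_pos u).
    apply (proj2 (Rlt_div_l K eps (1 + u ^ 2) ltac:(lra))). apply (proj1 (Rlt_div_l K _ eps ltac:(lra))) in H1.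
    rewrite <- (pow2_abs u). assert (Rabs u <= 1 + Rabs u ^ 2) by nra.
    assert (Rabs u * eps <= (1 + Rabs u ^ 2) * eps) by (apply Rmult_le_compat_r; lra). lra. }
  split; apply filterlim_locally; intros eps.
  - exists (- (Rmax (K / eps) 1)). intros u Hu.
    pose proof (Rmax_l (K / eps) 1). pose proof (Rmax_r (K / eps) 1).
    apply Rabs_ball, X; rewrite Rabs_left; lra.
  - exists (Rmax (K / eps) 1). intros u Hu.
    pose proof (Rmax_l (K / eps) 1). pose proof (Rmax_r (K / eps) 1).
    apply Rabs_ball, X; rewrite Rabs_right; lra.
Qed.

(** Integration by parts is obtained by taking a product for [P]: a dominated function tends to 0 at
    both ends, so there are no boundary terms. *)
Lemma Jint_derive_0 K K' h P : cauchy_dom K h -> cauchy_dom K' P ->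
  (forall u, is_derive P u (h u)) -> Jint h = 0.
Proof.
  intros H H' Hd. destruct (cauchy_dom_lim K' P H').
  rewrite (Jint_FTC K h P 0 0); auto. ring.
Qed.

(** Symmetric bounds suit the transforms below, which are even or odd in [t]. *)
Lemma Jint_lim_sym K h : cauchy_dom K h -> filterlim (fun T => RInt h (- T) T) pinf (locally (Jint h)).
Proof.
  intros H. pose proof (cauchy_dom_is K h H) as E.
  intros P HP. specialize (E P HP). unfold filtermapi in E. unfold filtermap.
  destruct E as [Q S [A HA] [B HB] HQS].
  exists (Rmax (- A) B). intros T HT.
  pose proof (Rmax_l (- A) B). pose proof (Rmax_r (- A) B).
  destruct (HQS (- T) T) as [y [Hy HPy]]; [apply HA; lra|apply HB; lra|].
  simpl in Hy. rewrite (is_RInt_unique _ _ _ _ Hy). exact HPy.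
Qed.

Lemma Jint_shift K K' h a : cauchy_dom K h -> cauchy_dom K' (fun u => h (u + a)) ->
  Jint (fun u => h (u + a)) = Jint h.
Proof.
  intros H H'. apply Jint_unique. pose proof (cauchy_dom_is K h H) as E.
  intros P HP. specialize (E P HP). unfold filtermapi in *.
  destruct E as [Q S [A HA] [B HB] HQS].
  apply (Filter_prod minf pinf _ (fun x => x < A - a) (fun x => B - a < x)).
  - exists (A - a); auto.
  - exists (B - a); auto.
  - intros x y Hx Hy. simpl.
    destruct (HQS (x + a) (y + a)) as [l [Hl HPl]]; [apply HA; lra|apply HB; lra|].
    exists l; split; auto. simpl in Hl.
    apply (is_RInt_ext (fun u => scal 1 (h (1 * u + a)))).
    { intros u _. unfold scal; simpl; unfold mult; simpl. rewrite !Rmult_1_l. reflexivity. }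
    apply (is_RInt_comp_lin (V := R_NormedModule) h 1 a x y l). rewrite !Rmult_1_l. exact Hl.
Qed.

(** On each segment of the positive half-line this is the ordinary substitution, and [ln] sends
    right neighbourhoods of 0 to neighbourhoods of minus infinity. Continuity is asked at positive
    points only, as powers of [x] may be singular at 0. *)
Lemma Jint_exp_subst (h : R -> R) (l : R) : (forall x, 0 < x -> continuous h x) ->
  is_RInt_gen (fun u => h (exp u) * exp u) minf pinf l ->
  is_RInt_gen h (at_right 0) pinf l.
Proof.
  intros Hc E P HP. specialize (E P HP). unfold filtermapi in *.
  destruct E as [Q S [A HA] [B HB] HQS].
  apply (Filter_prod (at_right 0) pinf _ (fun x => 0 < x < exp A) (fun x => exp B < x)).
  - exists (mkposreal _ (exp_pos A)). intros y Hy Hy0. apply ball_Rabs in Hy.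
    simpl in Hy. apply Rabs_def2 in Hy. lra.
  - exists (exp B); auto.
  - intros x y [Hx0 Hx] Hy. simpl.
    assert (Hy0 : 0 < y) by (pose proof (exp_pos B); lra).
    destruct (HQS (ln x) (ln y)) as [m [Hm HPm]].
    + apply HA. rewrite <- (ln_exp A). apply ln_increasing; auto.
    + apply HB. rewrite <- (ln_exp B). apply ln_increasing; auto using exp_pos.
    + exists m; split; auto. simpl in Hm.
      pose proof (is_RInt_comp h exp exp (ln x) (ln y)) as I.
      rewrite !exp_ln in I by auto.
      assert (I' := I (fun u _ => Hc _ (exp_pos u))
        (fun u _ => conj (is_derive_exp u) (is_derive_Rcontinuous _ _ _ (is_derive_exp u)))).
      apply (is_RInt_ext _ (fun u => h (exp u) * exp u)) in I'.
      2:{ intros u _. unfold scal; simpl; unfold mult; simpl. ring. }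
      rewrite <- (is_RInt_unique _ _ _ _ Hm), (is_RInt_unique _ _ _ _ I').
      apply (RInt_correct (V := R_CompleteNormedModule)). apply (ex_RInt_continuous (V := R_CompleteNormedModule)).
      intros z [Hz _]. apply Hc. eapply Rlt_le_trans; [|exact Hz].
      apply Rmin_glb_lt; auto.
Qed.

(** Dominated convergence for series. The remainder after a partial sum is again in the class, with
    a tail of [M] as its constant; this gives uniform convergence, hence continuity of the sum, and
    an error of at most that tail times [PI] after integration. *)
Lemma cauchy_dom_series (h : nat -> R -> R) (M : nat -> R) :
  (forall n, cauchy_dom (M n) (h n)) -> ex_series M ->
  (forall u, ex_series (fun n => h n u)) /\
  cauchy_dom (Series M) (fun u => Series (fun n => h n u)) /\
  is_series (fun n => Jint (h n)) (Jint (fun u => Series (fun n => h n u))).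
Proof.
  intros Hh HM.
  assert (HM0 : forall n, 0 <= M n) by (intros n; apply (cauchy_dom_nonneg _ _ (Hh n))).
  assert (Hmaj : forall u, ex_series (fun n => M n / (1 + u ^ 2))).
  { intros u. apply (ex_series_scal_r (/ (1 + u ^ 2)) M HM). }
  assert (Habs : forall u, ex_series (fun n => Rabs (h n u))).
  { intros u. apply (ex_series_le (fun n => Rabs (h n u)) (fun n => M n / (1 + u ^ 2))); auto.
    intros n. change (Rabs (Rabs (h n u)) <= M n / (1 + u ^ 2)). rewrite Rabs_Rabsolu. apply Hh. }
  assert (Hex : forall u, ex_series (fun n => h n u)).
  { intros u. apply ex_series_Rabs, Habs. }
  split; auto.
  (* [sum_f_R0] up to [N] has [N + 1] terms, so the remainder starts at index [S N]. *)
  set (tail := fun N => Series (fun k => M (S N + k)%nat)).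
  assert (HMN : forall N, ex_series (fun k => M (N + k)%nat)).
  { intros N. apply ex_series_incr_n; auto. }
  assert (Htail : forall N u, Rabs (Series (fun n => h n u) - sum_f_R0 (fun n => h n u) N)
                     <= tail N / (1 + u ^ 2)).
  { intros N u. rewrite (Series_incr_n (fun n => h n u) (S N)) by (auto; lia).
    simpl pred. replace (_ + _ - _) with (Series (fun k => h (S N + k)%nat u)) by ring.
    eapply Rle_trans; [apply Series_Rabs|].
    - apply (proj1 (ex_series_incr_n (fun n => Rabs (h n u)) (S N))); auto.
    - unfold tail. unfold Rdiv. rewrite <- Series_scal_r. apply Series_le.
      + intros n. split; [apply Rabs_pos|]. apply Hh.
      + apply (ex_series_scal_r (/ (1 + u ^ 2))). apply HMN. }
  assert (Htl : forall eps : posreal, exists N0, forall N, (N0 <= N)%nat -> tail N < eps).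
  { intros eps. destruct HM as [l Hl]. pose proof (is_series_unique _ _ Hl) as El.
    destruct (proj1 (filterlim_locally _ _) Hl eps) as [N0 HN0].
    exists N0. intros N HN. specialize (HN0 N HN). apply ball_Rabs in HN0.
    rewrite sum_n_Reals in HN0. unfold tail.
    pose proof (Series_incr_n M (S N)) as E. simpl pred in E.
    rewrite El in E. specialize (E ltac:(lia) ltac:(exists l; auto)).
    apply Rabs_def2 in HN0. lra. }
  assert (Htl0 : forall N, 0 <= tail N).
  { intros N. eapply Rle_trans; [apply Rabs_pos|].
    replace (tail N) with (tail N / (1 + 0 ^ 2)) by field. apply Htail. }
  assert (Hcs : forall N u, continuous (fun v => sum_f_R0 (fun n => h n v) N) u).
  { intros N u. induction N as [|N IH]; simpl.
    - apply Hh.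
    - apply (Rcontinuous_plus _ (h (S N))); auto. apply Hh. }
  assert (Hdom : cauchy_dom (Series M) (fun u => Series (fun n => h n u))).
  { split.
    - intros u. apply filterlim_locally. intros eps.
      assert (He3 : 0 < eps / 3) by (pose proof (cond_pos eps); lra).
      destruct (Htl (mkposreal _ He3)) as [N HN]. specialize (HN N (le_n N)). simpl in HN.
      pose proof (proj1 (filterlim_locally _ _) (Hcs N u) (mkposreal _ He3)) as L.
      apply (filter_imp (F := locally u)) with (2 := L). intros v Hv.
      apply ball_Rabs in Hv. apply Rabs_ball. simpl in Hv.
      assert (T1 : forall v, Rabs (Series (fun n => h n v) - sum_f_R0 (fun n => h n v) N) <= tail N).
      { intros w. eapply Rle_trans; [apply Htail|]. specialize (Htl0 N). pose proof (one_sq_pos w).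
        apply (proj2 (Rle_div_l _ _ (1 + w ^ 2) ltac:(lra))). nra. }
      pose proof (T1 v) as A1. pose proof (T1 u) as A2.
      apply Rabs_le_between in A1. apply Rabs_le_between in A2. apply Rabs_def2 in Hv.
      apply Rabs_def1; lra.
    - intros u. eapply Rle_trans; [apply Series_Rabs; auto|].
      unfold Rdiv. rewrite <- Series_scal_r. apply Series_le; auto.
      + intros n. split; [apply Rabs_pos|]. apply Hh.
      + apply Hmaj. }
  split; auto.
  assert (Hsum : forall N, exists K, cauchy_dom K (fun u => sum_f_R0 (fun n => h n u) N) /\
      Jint (fun u => sum_f_R0 (fun n => h n u) N) = sum_f_R0 (fun n => Jint (h n)) N).
  { induction N as [|N [K [IH1 IH2]]]; simpl.
    - exists (M O). split; [apply Hh|]. reflexivity.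
    - exists (K + M (S N)). split.
      + apply (cauchy_dom_plus _ _ _ (h (S N))); auto.
      + rewrite (Jint_plus K (M (S N)) _ (h (S N))); auto. rewrite IH2; reflexivity. }
  apply filterlim_locally. intros eps.
  (* The integrated remainder is at most [tail N * PI], and [PI <= 4]. *)
  assert (He4 : 0 < eps / 4) by (pose proof (cond_pos eps); lra).
  destruct (Htl (mkposreal _ He4)) as [N0 HN0]. simpl in HN0.
  exists N0. intros N HN. specialize (HN0 N HN).
  apply Rabs_ball. rewrite sum_n_Reals.
  destruct (Hsum N) as [K [HK1 HK2]]. rewrite <- HK2.
  rewrite Rabs_minus_sym, <- (Jint_minus (Series M) K); auto.
  eapply Rle_lt_trans; [apply (Jint_bound (tail N))|].
  - split; [|apply Htail]. intros u. apply Rcontinuous_minus; auto. apply Hdom.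
  - pose proof PI_4. pose proof PI_RGT_0. specialize (Htl0 N). nra.
Qed.

(** * Cosine and sine transforms *)

(* The weight [1 + |u|] pays for one derivative of [cos (t u)] in [t]. *)
Definition moment_dom (L : R) (p : R -> R) : Prop :=
  (forall u, continuous p u) /\
  (forall u, Rabs (p u) * (1 + Rabs u) <= L / (1 + u ^ 2)).

Lemma moment_dom_mult L A p g : moment_dom L p -> (forall u, continuous g u) ->
  (forall u, Rabs (g u) <= A * (1 + Rabs u)) -> cauchy_dom (A * L) (fun u => p u * g u).
Proof.
  intros [Hc Hb] Hg HA; split.
  - intros u. apply Rcontinuous_mult; auto.
  - intros u. specialize (Hb u). specialize (HA u). pose proof (Rabs_pos u).
    pose proof (Rabs_pos (p u)). pose proof (Rabs_pos (g u)).
    assert (HA0 : 0 <= A) by nra.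
    rewrite Rabs_mult.
    replace (A * L / (1 + u ^ 2)) with (A * (L / (1 + u ^ 2))) by (unfold Rdiv; ring).
    apply Rle_trans with (A * (Rabs (p u) * (1 + Rabs u))).
    + replace (A * (Rabs (p u) * (1 + Rabs u))) with (Rabs (p u) * (A * (1 + Rabs u))) by ring.
      apply Rmult_le_compat_l; auto.
    + apply Rmult_le_compat_l; auto.
Qed.

Lemma moment_dom_bounded_mult L A p g : moment_dom L p -> (forall u, continuous g u) ->
  (forall u, Rabs (g u) <= A) -> cauchy_dom (A * L) (fun u => p u * g u).
Proof.
  intros Hp Hg HA. apply moment_dom_mult; auto.
  intros u. specialize (HA u). pose proof (Rabs_pos u). pose proof (Rabs_pos (g u)). nra.
Qed.

Lemma moment_dom_cauchy L p : moment_dom L p -> cauchy_dom L p.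
Proof.
  intros Hp. apply (cauchy_dom_ext L (fun u => p u * 1)); [intros; ring|].
  rewrite <- (Rmult_1_l L). apply moment_dom_bounded_mult; auto.
  - intros u; apply continuous_const.
  - intros u; rewrite Rabs_R1; lra.
Qed.

Lemma moment_dom_nonneg L p : moment_dom L p -> 0 <= L.
Proof. intros H. exact (cauchy_dom_nonneg _ _ (moment_dom_cauchy L p H)). Qed.

Lemma cauchy_dom_bounded K p : cauchy_dom K p -> forall u, Rabs (p u) <= K.
Proof.
  intros H u. eapply Rle_trans; [apply H|]. pose proof (cauchy_dom_nonneg _ _ H).
  pose proof (one_sq_pos u). apply (proj2 (Rle_div_l K K (1 + u ^ 2) ltac:(lra))). nra.
Qed.

Lemma Rabs_cos_le x : Rabs (cos x) <= 1.
Proof. apply Rabs_le, COS_bound. Qed.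

Lemma Rabs_sin_le x : Rabs (sin x) <= 1.
Proof. apply Rabs_le, SIN_bound. Qed.

Definition Cos_tr (p : R -> R) (t : R) : R := Jint (fun u => p u * cos (t * u)).
Definition Sin_tr (p : R -> R) (t : R) : R := Jint (fun u => p u * sin (t * u)).

Lemma continuous_cos_lin t u : continuous (fun v => cos (t * v)) u.
Proof. cont_by_derive. Qed.

Lemma continuous_sin_lin t u : continuous (fun v => sin (t * v)) u.
Proof. cont_by_derive. Qed.

Lemma moment_dom_cos L p t : moment_dom L p -> cauchy_dom L (fun u => p u * cos (t * u)).
Proof.
  intros H. rewrite <- (Rmult_1_l L). apply moment_dom_bounded_mult; auto using Rabs_cos_le, continuous_cos_lin.
Qed.

Lemma moment_dom_sin L p t : moment_dom L p -> cauchy_dom L (fun u => p u * sin (t * u)).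
Proof.
  intros H. rewrite <- (Rmult_1_l L). apply moment_dom_bounded_mult; auto using Rabs_sin_le, continuous_sin_lin.
Qed.

Lemma lipschitz_of_derive (f df : R -> R) (M : R) :
  (forall x, is_derive f x (df x)) -> (forall x, Rabs (df x) <= M) ->
  forall x y, Rabs (f y - f x) <= M * Rabs (y - x).
Proof.
  intros Hd HM x y. destruct (MVT_gen f x y df) as [c [_ Hc]].
  - intros z _; apply Hd.
  - intros z _. apply continuity_pt_filterlim. exact (is_derive_Rcontinuous _ _ _ (Hd z)).
  - rewrite Hc, Rabs_mult. apply Rmult_le_compat_r; auto using Rabs_pos.
Qed.

Lemma cos_lipschitz u t t' : Rabs (cos (t' * u) - cos (t * u)) <= Rabs (t' - t) * (1 + Rabs u).
Proof.
  eapply Rle_trans; [apply (lipschitz_of_derive cos (fun x => - sin x) 1)|].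
  - intros x. auto_derive; auto. ring.
  - intros x. rewrite Rabs_Ropp. apply Rabs_sin_le.
  - rewrite <- Rmult_minus_distr_r, Rabs_mult. pose proof (Rabs_pos u). pose proof (Rabs_pos (t' - t)). nra.
Qed.

Lemma sin_lipschitz u t t' : Rabs (sin (t' * u) - sin (t * u)) <= Rabs (t' - t) * (1 + Rabs u).
Proof.
  eapply Rle_trans; [apply (lipschitz_of_derive sin cos 1)|].
  - intros x. auto_derive; auto. ring.
  - intros x. apply Rabs_cos_le.
  - rewrite <- Rmult_minus_distr_r, Rabs_mult. pose proof (Rabs_pos u). pose proof (Rabs_pos (t' - t)). nra.
Qed.

Lemma lipschitz_continuous (f : R -> R) M : (forall x y, Rabs (f y - f x) <= Rabs (y - x) * M) ->
  forall x, continuous f x.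
Proof.
  intros H x. apply filterlim_locally. intros eps.
  assert (HM : 0 < Rmax M 0 + 1) by (pose proof (Rmax_r M 0); lra).
  assert (Hd : 0 < eps / (Rmax M 0 + 1)) by (apply Rdiv_lt_0_compat; auto; apply cond_pos).
  exists (mkposreal _ Hd). intros y Hy. apply ball_Rabs in Hy. simpl in Hy.
  apply Rabs_ball. eapply Rle_lt_trans; [apply H|].
  apply (proj2 (Rlt_div_r (Rabs (y - x)) eps (Rmax M 0 + 1) HM)) in Hy.
  eapply Rle_lt_trans; [|exact Hy]. apply Rmult_le_compat_l; [apply Rabs_pos|].
  pose proof (Rmax_l M 0); lra.
Qed.

(** The first moment makes the transform Lipschitz in [t]: moving [t] to [t'] changes the cosine by
    at most [Rabs (t' - t) * (1 + Rabs u)]. *)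
Lemma continuous_Cos_tr L p : moment_dom L p -> forall t, continuous (Cos_tr p) t.
Proof.
  intros H. apply (lipschitz_continuous _ (L * PI)). intros t t'. unfold Cos_tr.
  rewrite <- (Jint_minus L L) by (apply moment_dom_cos; auto).
  rewrite <- Rmult_assoc. apply Jint_bound.
  apply (cauchy_dom_ext _ (fun u => p u * (cos (t' * u) - cos (t * u)))); [intros; ring|].
  apply moment_dom_mult; auto using cos_lipschitz.
  intros u. apply Rcontinuous_minus; apply continuous_cos_lin.
Qed.

Lemma continuous_Sin_tr L p : moment_dom L p -> forall t, continuous (Sin_tr p) t.
Proof.
  intros H. apply (lipschitz_continuous _ (L * PI)). intros t t'. unfold Sin_tr.
  rewrite <- (Jint_minus L L) by (apply moment_dom_sin; auto).
  rewrite <- Rmult_assoc. apply Jint_bound.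
  apply (cauchy_dom_ext _ (fun u => p u * (sin (t' * u) - sin (t * u)))); [intros; ring|].
  apply moment_dom_mult; auto using sin_lipschitz.
  intros u. apply Rcontinuous_minus; apply continuous_sin_lin.
Qed.

Lemma Ris_derive_mult (f g : R -> R) (x l m : R) : is_derive f x l -> is_derive g x m ->
  is_derive (fun y => f y * g y) x (l * g x + f x * m).
Proof. intros Hf Hg. apply (is_derive_mult f g x l m Hf Hg). intros; apply Rmult_comm. Qed.

(** The derivatives of [p u * cos (t * u)] and [p u * sin (t * u)] integrate to 0, which moves the
    derivative from [p] to the trigonometric factor. *)
Lemma tr_parts L L' p p' t : moment_dom L p -> moment_dom L' p' ->
  (forall u, is_derive p u (p' u)) ->
  Cos_tr p' t = t * Sin_tr p t /\ Sin_tr p' t = - t * Cos_tr p t.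
Proof.
  intros H H' Hd. unfold Cos_tr, Sin_tr.
  pose proof (moment_dom_cos L p t H) as C0. pose proof (moment_dom_sin L p t H) as S0.
  pose proof (moment_dom_cos L' p' t H') as C1. pose proof (moment_dom_sin L' p' t H') as S1.
  rewrite <- (Jint_scal L t), <- (Jint_scal L (- t)) by auto.
  pose proof (cauchy_dom_scal L t _ S0) as S0'.
  pose proof (cauchy_dom_scal L (- t) _ C0) as C0'. split.
  - apply Rminus_diag_uniq. rewrite <- (Jint_minus L' (Rabs t * L)) by auto.
    apply (Jint_derive_0 (L' + Rabs t * L) L _ (fun u => p u * cos (t * u))); auto.
    + apply cauchy_dom_minus; auto.
    + intros u. evar_last.
      * apply (Ris_derive_mult p (fun v => cos (t * v)) u (p' u) (- t * sin (t * u))); auto.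
        auto_derive; auto. ring.
      * ring.
  - apply Rminus_diag_uniq. rewrite <- (Jint_minus L' (Rabs (- t) * L)) by auto.
    apply (Jint_derive_0 (L' + Rabs (- t) * L) L _ (fun u => p u * sin (t * u))); auto.
    + apply cauchy_dom_minus; auto.
    + intros u. evar_last.
      * apply (Ris_derive_mult p (fun v => sin (t * v)) u (p' u) (t * cos (t * u))); auto.
        auto_derive; auto. ring.
      * ring.
Qed.

(** Two integrations by parts give [Cos_tr p2 t = - t ^ 2 * Cos_tr p0 t]. Up to the factor [PI],
    [L0] bounds the transform itself and [L2] bounds it times [t ^ 2]; adding the two yields the
    factor [1 + t ^ 2]. *)
Lemma tr_decay L0 L1 L2 p0 p1 p2 :
  moment_dom L0 p0 -> moment_dom L1 p1 -> moment_dom L2 p2 ->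
  (forall u, is_derive p0 u (p1 u)) -> (forall u, is_derive p1 u (p2 u)) ->
  cauchy_dom ((L0 + L2) * PI) (Cos_tr p0) /\ cauchy_dom ((L0 + L2) * PI) (Sin_tr p0).
Proof.
  intros H0 H1 H2 D0 D1.
  assert (X : forall t, Rabs (Cos_tr p0 t) <= (L0 + L2) * PI / (1 + t ^ 2) /\
                        Rabs (Sin_tr p0 t) <= (L0 + L2) * PI / (1 + t ^ 2)).
  { intros t. destruct (tr_parts L0 L1 p0 p1 t H0 H1 D0) as [E1 E2].
    destruct (tr_parts L1 L2 p1 p2 t H1 H2 D1) as [E3 E4].
    pose proof (Jint_bound _ _ (moment_dom_cos L0 p0 t H0)) as B1.
    pose proof (Jint_bound _ _ (moment_dom_sin L0 p0 t H0)) as B2.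
    pose proof (Jint_bound _ _ (moment_dom_cos L2 p2 t H2)) as B3.
    pose proof (Jint_bound _ _ (moment_dom_sin L2 p2 t H2)) as B4.
    fold (Cos_tr p0 t) in B1. fold (Sin_tr p0 t) in B2.
    fold (Cos_tr p2 t) in B3. fold (Sin_tr p2 t) in B4.
    rewrite E3, E2 in B3. rewrite E4, E1 in B4.
    replace (t * (- t * Cos_tr p0 t)) with (- (t ^ 2 * Cos_tr p0 t)) in B3 by ring.
    replace (- t * (t * Sin_tr p0 t)) with (- (t ^ 2 * Sin_tr p0 t)) in B4 by ring.
    rewrite Rabs_Ropp, Rabs_mult, (Rabs_right (t ^ 2)) in B3, B4 by nra.
    pose proof (one_sq_pos t).
    split; apply (proj1 (Rle_div_r _ _ (1 + t ^ 2) ltac:(lra))); nra. }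
  split; split.
  - exact (continuous_Cos_tr L0 p0 H0).
  - intros t. exact (proj1 (X t)).
  - exact (continuous_Sin_tr L0 p0 H0).
  - intros t. exact (proj2 (X t)).
Qed.

(** * Differentiation under the integral sign *)

(** Two applications of the mean value theorem suffice, at the price of [M] where Taylor's formula
    gives [M / 2]. The bound on [f2] is asked only near [T] because the intended second derivative
    contains [exp (- e * s)], unbounded over all [s]. *)
Lemma taylor2_bound (f f1 f2 : R -> R) (T h M : R) :
  (forall x, is_derive f x (f1 x)) -> (forall x, is_derive f1 x (f2 x)) ->
  (forall x, Rabs (x - T) <= Rabs h -> Rabs (f2 x) <= M) ->
  Rabs (f (T + h) - f T - h * f1 T) <= h ^ 2 * M.
Proof.
  intros D1 D2 HM.
  assert (in_range : forall c z, Rabs (z - T) <= Rabs h -> Rmin T z <= c <= Rmax T z ->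
     Rabs (c - T) <= Rabs h).
  { intros c z Hz [Hc1 Hc2]. eapply Rle_trans; [|exact Hz].
    unfold Rmin, Rmax in *. destruct (Rle_dec T z).
    - rewrite !Rabs_right; lra.
    - rewrite !Rabs_left1; lra. }
  destruct (MVT_gen f T (T + h) f1) as [c [Hc Ec]].
  { intros; apply D1. }
  { intros z _. apply continuity_pt_filterlim. exact (is_derive_Rcontinuous _ _ _ (D1 z)). }
  destruct (MVT_gen f1 T c f2) as [d [Hd Ed]].
  { intros; apply D2. }
  { intros z _. apply continuity_pt_filterlim. exact (is_derive_Rcontinuous _ _ _ (D2 z)). }
  assert (Rc : Rabs (c - T) <= Rabs h).
  { apply (in_range c (T + h)); auto. replace (T + h - T) with h by ring. lra. }
  assert (Rd : Rabs (d - T) <= Rabs h) by (apply (in_range d c); auto).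
  replace (f (T + h) - f T - h * f1 T) with (h * (f2 d * (c - T))).
  2:{ rewrite <- Ed, Ec. ring. }
  rewrite !Rabs_mult. specialize (HM d Rd).
  pose proof (Rabs_pos h). pose proof (Rabs_pos (f2 d)). pose proof (Rabs_pos (c - T)).
  rewrite <- (pow2_abs h).
  apply Rle_trans with (Rabs h * (M * Rabs h)); [|right; ring].
  apply Rmult_le_compat_l; auto. apply Rmult_le_compat; auto.
Qed.

(** The quadratic Taylor error is integrable against [p], so the difference quotient is off by at
    most [Rabs h * (A * L * PI)]. The growth [1 + Rabs u] allowed in the error is paid for by the
    weight in [moment_dom]. *)
Lemma Jint_derive_param L A p (S S' : R -> R -> R) (T : R) : moment_dom L p ->
  (forall s u, continuous (S s) u) -> (forall u, continuous (S' T) u) ->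
  (forall s u, Rabs (s - T) <= 1 -> Rabs (S s u) <= A * (1 + Rabs u)) ->
  (forall u, Rabs (S' T u) <= A * (1 + Rabs u)) ->
  (forall h u, Rabs h <= 1 -> Rabs (S (T + h) u - S T u - h * S' T u) <= h ^ 2 * (A * (1 + Rabs u))) ->
  is_derive (fun s => Jint (fun u => p u * S s u)) T (Jint (fun u => p u * S' T u)).
Proof.
  intros Hp cS cS' bS bS' HT. apply is_derive_Reals. intros eps Heps.
  pose proof (moment_dom_nonneg L p Hp) as HL. pose proof PI_RGT_0 as HPI.
  assert (HA : 0 <= A).
  { specialize (bS' 0). rewrite Rabs_R0 in bS'. pose proof (Rabs_pos (S' T 0)). lra. }
  assert (HB : 0 < A * L * PI + 1) by (assert (0 <= A * L) by nra; nra).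
  (* The bound 1 keeps [T + h] where [S] is controlled; the other makes [Rabs h * (A * L * PI)]
     smaller than [eps]. *)
  assert (Hd : 0 < Rmin 1 (eps / (A * L * PI + 1))).
  { apply Rmin_glb_lt; [lra|]. apply Rdiv_lt_0_compat; auto. }
  exists (mkposreal _ Hd). intros h Hh0 Hh. simpl in Hh.
  assert (Hh1 : Rabs h <= 1) by (pose proof (Rmin_l 1 (eps / (A * L * PI + 1))); lra).
  assert (Hh2 : Rabs h < eps / (A * L * PI + 1)) by (pose proof (Rmin_r 1 (eps / (A * L * PI + 1))); lra).
  assert (W0 : cauchy_dom (A * L) (fun u => p u * S T u)).
  { apply moment_dom_mult; auto. intros u; apply bS. rewrite Rminus_diag_eq, Rabs_R0 by auto; lra. }
  assert (W1 : cauchy_dom (A * L) (fun u => p u * S (T + h) u)).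
  { apply moment_dom_mult; auto. intros u; apply bS. replace (T + h - T) with h by ring; auto. }
  assert (W2 : cauchy_dom (A * L) (fun u => p u * S' T u)).
  { apply moment_dom_mult; auto. }
  assert (B : Rabs (Jint (fun u => p u * S (T + h) u) - Jint (fun u => p u * S T u)
                    - h * Jint (fun u => p u * S' T u)) <= h ^ 2 * A * L * PI).
  { rewrite <- (Jint_minus (A * L) (A * L)), <- (Jint_scal (A * L)) by auto.
    rewrite <- (Jint_minus (A * L + A * L) (Rabs h * (A * L)));
      [|apply cauchy_dom_minus; auto|apply cauchy_dom_scal; auto].
    apply Jint_bound.
    apply (cauchy_dom_ext _ (fun u => p u * (S (T + h) u - S T u - h * S' T u))); [intros; ring|].
    apply moment_dom_mult; auto.
    - intros u. apply Rcontinuous_minus; [apply Rcontinuous_minus; auto|].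
      apply Rcontinuous_mult; auto. apply continuous_const.
    - intros u. rewrite Rmult_assoc. apply HT; auto. }
  replace ((Jint (fun u => p u * S (T + h) u) - Jint (fun u => p u * S T u)) / h
           - Jint (fun u => p u * S' T u)) with
    ((Jint (fun u => p u * S (T + h) u) - Jint (fun u => p u * S T u)
                    - h * Jint (fun u => p u * S' T u)) / h) by (field; auto).
  unfold Rdiv. rewrite Rabs_mult, Rabs_inv.
  assert (Hah : 0 < Rabs h) by (apply Rabs_pos_lt; auto).
  apply Rle_lt_trans with (Rabs h * (A * L * PI)).
  - apply (proj2 (Rle_div_l _ _ (Rabs h) Hah)).
    eapply Rle_trans; [exact B|]. rewrite <- (pow2_abs h). right; ring.
  - apply (proj2 (Rlt_div_r _ _ _ HB)) in Hh2. nra.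
Qed.

(** * Fourier inversion at the origin *)

(* The antiderivative in [s] of [exp (- e s) cos (s u)] vanishing at infinity. *)
Definition abel_prim (e s u : R) : R :=
  exp (- e * s) * (u * sin (s * u) - e * cos (s * u)) / (e ^ 2 + u ^ 2).

Lemma sq_sum_pos e u : 0 < e -> 0 < e ^ 2 + u ^ 2.
Proof. nra. Qed.

Lemma is_derive_abel_prim e s u : 0 < e ->
  is_derive (fun s => abel_prim e s u) s (exp (- e * s) * cos (s * u)).
Proof.
  intros He. pose proof (sq_sum_pos e u He). unfold abel_prim.
  auto_derive; auto. field. lra.
Qed.

Lemma continuous_abel_prim e s u : 0 < e -> continuous (abel_prim e s) u.
Proof.
  intros He. pose proof (sq_sum_pos e u He). unfold abel_prim. cont_by_derive. lra.
Qed.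

(** Being uniform in [u] and decaying in [s], this bound removes the upper boundary term when the
    damped integral is extended to infinity. *)
Lemma abel_prim_bound e s u : 0 < e -> Rabs (abel_prim e s u) <= exp (- e * s) * (2 / e).
Proof.
  intros He. pose proof (sq_sum_pos e u He) as Hp. unfold abel_prim, Rdiv at 1.
  rewrite Rmult_assoc, Rabs_mult, (Rabs_right (exp _)) by (left; apply exp_pos).
  apply Rmult_le_compat_l; [left; apply exp_pos|].
  rewrite Rabs_mult, Rabs_inv, (Rabs_right (e ^ 2 + u ^ 2)) by lra.
  apply (proj2 (Rle_div_l _ _ _ Hp)).
  replace (2 / e * (e ^ 2 + u ^ 2)) with (2 * e + 2 * u ^ 2 / e) by (field; lra).
  eapply Rle_trans; [apply Rabs_triang|]. rewrite Rabs_Ropp, !Rabs_mult, (Rabs_right e) by lra.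
  pose proof (Rabs_sin_le (s * u)). pose proof (Rabs_cos_le (s * u)).
  pose proof (Rabs_pos u). pose proof (Rabs_pos (sin (s * u))). pose proof (Rabs_pos (cos (s * u))).
  apply Rle_trans with (Rabs u + e); [nra|].
  rewrite <- (pow2_abs u). set (a := Rabs u) in *.
  (* Multiplied by [e] this is [e ^ 2 - a * e + 2 * a ^ 2 >= 0], a quadratic form of negative
     discriminant. *)
  assert (a <= e + 2 * a ^ 2 / e); [|lra].
  replace (e + 2 * a ^ 2 / e) with ((e ^ 2 + 2 * a ^ 2) / e) by (field; lra).
  apply (proj1 (Rle_div_r _ _ e He)). nra.
Qed.

Lemma is_derive_Jint_abel e L p T : 0 < e -> moment_dom L p ->
  is_derive (fun s => Jint (fun u => p u * abel_prim e s u)) T (exp (- e * T) * Cos_tr p T).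
Proof.
  intros He Hp.
  assert (HE : forall s, Rabs (s - T) <= 1 -> exp (- e * s) <= exp (e * (Rabs T + 1))).
  { intros s Hs. assert (H : - e * s <= e * (Rabs T + 1)).
    { apply Rabs_le_between in Hs. pose proof (Rabs_pos T). pose proof (Rle_abs (- T)).
      rewrite Rabs_Ropp in *. nra. }
    destruct H as [H|H]; [left; apply exp_increasing; auto|rewrite H; right; auto]. }
  set (X := exp (e * (Rabs T + 1))) in *.
  assert (HX : 0 < X) by apply exp_pos.
  assert (He2 : 0 < 2 / e) by (apply Rdiv_lt_0_compat; lra).
  assert (Hu : forall u, 1 <= 1 + Rabs u) by (intros u; pose proof (Rabs_pos u); lra).
  (* One constant for three bounds: [2 / e] for the primitive, 1 for its first derivative in [s] and
     [1 + e] for the second, while [X] bounds [exp (- e * s)] for [s] within 1 of [T]. *)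
  set (A := X * (2 + e + 2 / e)).
  assert (HXA : X <= A) by (unfold A; nra).
  assert (HA2 : X * (2 / e) <= A) by (unfold A; nra).
  replace (exp (- e * T) * Cos_tr p T) with
    (Jint (fun u => p u * (exp (- e * T) * cos (T * u)))).
  2:{ unfold Cos_tr. rewrite <- (Jint_scal L) by (apply moment_dom_cos; auto).
      apply (Jint_ext (Rabs (exp (- e * T)) * L)); [|intros; ring].
      apply (cauchy_dom_ext _ (fun u => exp (- e * T) * (p u * cos (T * u)))); [intros; ring|].
      apply cauchy_dom_scal, moment_dom_cos; auto. }
  apply (Jint_derive_param L A p (abel_prim e) (fun s u => exp (- e * s) * cos (s * u))); auto.
  - intros; apply continuous_abel_prim; auto.
  - intros u. apply Rcontinuous_mult; [apply continuous_const|apply continuous_cos_lin].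
  - intros s u Hs. eapply Rle_trans; [apply abel_prim_bound; auto|].
    specialize (HE s Hs). specialize (Hu u).
    apply Rle_trans with (X * (2 / e)); [nra|]. nra.
  - intros u. rewrite Rabs_mult, (Rabs_right (exp _)) by (left; apply exp_pos).
    pose proof (Rabs_cos_le (T * u)). pose proof (Rabs_pos (cos (T * u))).
    assert (HT : exp (- e * T) <= X).
    { apply HE. rewrite Rminus_diag_eq, Rabs_R0 by auto. lra. }
    pose proof (exp_pos (- e * T)). specialize (Hu u). apply Rle_trans with (X * 1); nra.
  - intros h u Hh.
    apply (taylor2_bound (fun s => abel_prim e s u) (fun s => exp (- e * s) * cos (s * u))
      (fun s => exp (- e * s) * (- e * cos (s * u) - u * sin (s * u)))).
    + intros s. apply is_derive_abel_prim; auto.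
    + intros s. auto_derive; auto. ring.
    + intros s Hs. assert (HsX := HE s (Rle_trans _ _ _ Hs Hh)).
      rewrite Rabs_mult, (Rabs_right (exp _)) by (left; apply exp_pos).
      assert (B : Rabs (- e * cos (s * u) - u * sin (s * u)) <= (1 + e) * (1 + Rabs u)).
      { eapply Rle_trans; [apply Rabs_triang|].
        rewrite Rabs_Ropp, !Rabs_mult, Rabs_Ropp, (Rabs_right e) by lra.
        pose proof (Rabs_sin_le (s * u)). pose proof (Rabs_cos_le (s * u)).
        pose proof (Rabs_pos u). pose proof (Rabs_pos (sin (s * u))). pose proof (Rabs_pos (cos (s * u))).
        apply Rle_trans with (e + Rabs u); nra. }
      apply Rle_trans with (X * ((1 + e) * (1 + Rabs u))).
      * apply Rmult_le_compat; auto using Rabs_pos. left; apply exp_pos.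
      * rewrite <- Rmult_assoc. apply Rmult_le_compat_r; [specialize (Hu u); lra|].
        unfold A. apply Rmult_le_compat_l; lra.
Qed.

(** This takes the place of exchanging the integrals in [t] and [u]: the integral over [u] is a
    primitive in [T] of the damped transform. *)
Lemma RInt_abel e L p T : 0 < e -> moment_dom L p ->
  RInt (fun t => exp (- e * t) * Cos_tr p t) 0 T =
  Jint (fun u => p u * abel_prim e T u) - Jint (fun u => p u * abel_prim e 0 u).
Proof.
  intros He Hp. apply (is_RInt_unique (V := R_CompleteNormedModule)).
  apply (is_RInt_derive (V := R_CompleteNormedModule)
           (fun s => Jint (fun u => p u * abel_prim e s u)) (fun t => exp (- e * t) * Cos_tr p t) 0 T).
  - intros x _. apply (is_derive_Jint_abel e L); auto.
  - intros x _. apply (Rcontinuous_mult (fun t => exp (- e * t))).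
    + cont_by_derive.
    + apply (continuous_Cos_tr L); auto.
Qed.

(** The product [(e + / e) * (e ^ 2 + u ^ 2)] exceeds [e * (1 + u ^ 2)] by [e ^ 3 + u ^ 2 / e]. The
    constant blows up as [e] tends to 0, so it serves integrability only; estimates for small [e]
    rely on the exact mass [PI]. *)
Lemma abel_kernel_dom e : 0 < e -> cauchy_dom (e + / e) (fun u => e / (e ^ 2 + u ^ 2)).
Proof.
  intros He. pose proof (Rinv_0_lt_compat _ He). split; intros u; pose proof (sq_sum_pos e u He).
  - cont_by_derive. lra.
  - rewrite Rabs_right by (left; apply Rdiv_lt_0_compat; lra).
    pose proof (one_sq_pos u).
    apply (proj2 (Rle_div_l _ _ _ H0)).
    replace ((e + / e) / (1 + u ^ 2) * (e ^ 2 + u ^ 2)) with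
      (((e + / e) * (e ^ 2 + u ^ 2)) / (1 + u ^ 2)) by (field; lra).
    apply (proj1 (Rle_div_r _ _ _ H1)).
    replace ((e + / e) * (e ^ 2 + u ^ 2)) with (e * (1 + u ^ 2) + (e ^ 3 + / e * u ^ 2)) by (field; lra).
    assert (0 < e ^ 3) by (apply pow_lt; auto). nra.
Qed.

Lemma Jint_abel_kernel e : 0 < e -> Jint (fun u => e / (e ^ 2 + u ^ 2)) = PI.
Proof.
  intros He.
  rewrite (Jint_FTC (e + / e) _ (fun u => atan (/ e * u)) (- (PI / 2)) (PI / 2)).
  - field.
  - apply abel_kernel_dom; auto.
  - intros u. pose proof (sq_sum_pos e u He). auto_derive; auto. unfold Rsqr. field.
    split; nra.
  - apply (filterlim_comp _ _ _ (fun u => / e * u) atan minf minf); [|apply is_lim_atan_m].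
    replace m_infty with (Rbar_mult (/ e) m_infty) at 2.
    + apply filterlim_Rbar_mult_l.
    + pose proof (Rinv_0_lt_compat _ He). simpl. destruct (Rle_dec 0 (/ e)); [|lra].
      destruct (Rle_lt_or_eq_dec 0 (/ e) r); auto; lra.
  - apply (filterlim_comp _ _ _ (fun u => / e * u) atan pinf pinf); [|apply is_lim_atan_p].
    replace p_infty with (Rbar_mult (/ e) p_infty) at 2.
    + apply filterlim_Rbar_mult_l.
    + pose proof (Rinv_0_lt_compat _ He). simpl. destruct (Rle_dec 0 (/ e)); [|lra].
      destruct (Rle_lt_or_eq_dec 0 (/ e) r); auto; lra.
Qed.

(* Away from the origin the kernel is [O(e / u^2)], near it continuity of [p] is used. *)
Lemma abel_kernel_approx p B (eta : posreal) : (forall u, continuous p u) ->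
  (forall u, Rabs (p u) <= B) ->
  exists K, 0 <= K /\ forall e, 0 < e ->
    Rabs (Jint (fun u => p u * (e / (e ^ 2 + u ^ 2))) - PI * p 0) <= (eta + e * K) * PI.
Proof.
  intros Hc HB.
  destruct (proj1 (filterlim_locally _ _) (Hc 0) eta) as [d Hd].
  pose proof (cond_pos d) as Hd0. pose proof (cond_pos eta) as Heta.
  assert (HB0 : 0 <= B) by (eapply Rle_trans; [apply Rabs_pos|apply (HB 0)]).
  (* Chosen so that [K * (u ^ 2 / (1 + u ^ 2))] is at least [2 * B] as soon as [Rabs u >= d]. *)
  set (K := 2 * B * (1 + / d ^ 2)).
  assert (Hdi : 0 < / d ^ 2) by (apply Rinv_0_lt_compat; nra).
  assert (HK : 0 <= K) by (unfold K; apply Rmult_le_pos; lra).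
  exists K. split; auto. intros e He.
  pose proof (abel_kernel_dom e He) as W0.
  assert (W1 : cauchy_dom (B * (e + / e)) (fun u => p u * (e / (e ^ 2 + u ^ 2)))).
  { apply cauchy_dom_mult; auto. }
  (* The factor [u ^ 2] produces the gain in [e]: times the kernel, the second term is at most
     [e * K / (1 + u ^ 2)], since [u ^ 2 <= e ^ 2 + u ^ 2]. *)
  assert (Hpt : forall u, Rabs (p u - p 0) <= eta + K * (u ^ 2 / (1 + u ^ 2))).
  { intros u. pose proof (one_sq_pos u).
    assert (0 <= u ^ 2 / (1 + u ^ 2)) by (apply Rdiv_le_0_compat; nra).
    destruct (Rlt_le_dec (Rabs u) d) as [Hu|Hu].
    - assert (Hb : ball 0 d u) by (apply Rabs_ball; rewrite Rminus_0_r; auto).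
      apply Hd, ball_Rabs in Hb. nra.
    - assert (X : 2 * B <= K * (u ^ 2 / (1 + u ^ 2))).
      { unfold K. rewrite Rmult_assoc.
        rewrite <- (Rmult_1_r (2 * B)) at 1. apply Rmult_le_compat_l; [lra|].
        unfold Rdiv. rewrite <- Rmult_assoc. fold (Rdiv ((1 + / d ^ 2) * u ^ 2) (1 + u ^ 2)).
        apply (proj1 (Rle_div_r _ _ _ H)).
        assert (1 <= / d ^ 2 * u ^ 2); [|lra].
        rewrite <- (Rinv_l (d ^ 2)) by nra. apply Rmult_le_compat_l; [lra|].
        rewrite <- (pow2_abs u). nra. }
      eapply Rle_trans; [apply Rabs_triang|]. rewrite Rabs_Ropp.
      pose proof (HB u). pose proof (HB 0). lra. }
  rewrite <- (Jint_abel_kernel e He) at 1.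
  rewrite (Rmult_comm (Jint _) (p 0)), <- (Jint_scal _ (p 0) _ W0).
  rewrite <- (Jint_minus _ _ _ _ W1 (cauchy_dom_scal _ (p 0) _ W0)).
  pose proof (cauchy_dom_minus _ _ _ _ W1 (cauchy_dom_scal _ (p 0) _ W0)) as W2.
  pose proof (cauchy_dom_scal _ eta _ W0) as W3.
  assert (HeK : 0 <= e * K) by nra.
  pose proof (cauchy_dom_cauchy (e * K) HeK) as W4.
  apply Rle_trans with (Jint (fun u => eta * (e / (e ^ 2 + u ^ 2)) + e * K / (1 + u ^ 2))).
  - apply (Jint_abs_le _ _ _ _ W2 (cauchy_dom_plus _ _ _ _ W3 W4)).
    intros u. pose proof (one_sq_pos u). pose proof (sq_sum_pos e u He).
    replace (p u * (e / (e ^ 2 + u ^ 2)) - p 0 * (e / (e ^ 2 + u ^ 2)))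
      with ((p u - p 0) * (e / (e ^ 2 + u ^ 2))) by ring.
    assert (0 < e / (e ^ 2 + u ^ 2)) by (apply Rdiv_lt_0_compat; lra).
    rewrite Rabs_mult, (Rabs_right (e / _)) by lra.
    apply Rle_trans with ((eta + K * (u ^ 2 / (1 + u ^ 2))) * (e / (e ^ 2 + u ^ 2))).
    + apply Rmult_le_compat_r; [lra|apply Hpt].
    + rewrite Rmult_plus_distr_r. apply Rplus_le_compat_l.
      replace (K * (u ^ 2 / (1 + u ^ 2)) * (e / (e ^ 2 + u ^ 2)))
        with (e * K / (1 + u ^ 2) * (u ^ 2 / (e ^ 2 + u ^ 2))) by (field; lra).
      rewrite <- (Rmult_1_r (e * K / (1 + u ^ 2))) at 2.
      apply Rmult_le_compat_l; [apply Rdiv_le_0_compat; lra|].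
      apply (proj2 (Rle_div_l _ _ _ H0)). nra.
  - rewrite (Jint_plus _ _ _ _ W3 W4), (Jint_scal _ _ _ W0), Jint_abel_kernel, Jint_cauchy by auto.
    right; ring.
Qed.

(** Two sources of error: on [[0, T]] the damping is removed at relative cost
    [1 - exp (- e * t) <= e * T], and beyond [T] the damped integral is dropped at the cost of a
    tail of [K / (1 + t ^ 2)]. The second cost is free of [e], so [e] can later tend to 0 with [T]
    fixed. *)
Lemma abel_error e L K p T : 0 < e -> 0 <= T -> moment_dom L p -> cauchy_dom K (Cos_tr p) ->
  Rabs (RInt (Cos_tr p) 0 T - Jint (fun u => p u * (e / (e ^ 2 + u ^ 2))))
    <= e * T * K * (PI / 2) + K * (PI / 2 - atan T).
Proof.
  intros He HT Hp HK.
  pose proof (cauchy_dom_nonneg _ _ HK) as HK0. pose proof (moment_dom_nonneg _ _ Hp) as HL0.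
  pose proof PI_RGT_0 as HPI.
  set (g := fun t => exp (- e * t) * Cos_tr p t).
  assert (cg : forall t, continuous g t).
  { intros t. apply (Rcontinuous_mult (fun t => exp (- e * t))); [cont_by_derive|apply HK]. }
  assert (exp_le_1 : forall t, 0 <= t -> exp (- e * t) <= 1).
  { intros t Ht. rewrite <- exp_0. destruct (Rle_lt_or_eq_dec 0 t Ht) as [H|H].
    - left; apply exp_increasing; nra.
    - subst t. rewrite Rmult_0_r; lra. }
  assert (near : Rabs (RInt (Cos_tr p) 0 T - RInt g 0 T) <= e * T * K * (PI / 2)).
  { apply Rle_trans with (e * T * K * atan T - e * T * K * atan 0).
    - apply (norm_RInt_le (V := R_NormedModule) (fun t => Cos_tr p t - g t)
        (fun t => e * T * K / (1 + t ^ 2)) 0 T); auto.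
      + intros t [Ht0 Ht]. unfold g.
        replace (Cos_tr p t - exp (- e * t) * Cos_tr p t) with ((1 - exp (- e * t)) * Cos_tr p t) by ring.
        change (Rabs ((1 - exp (- e * t)) * Cos_tr p t) <= e * T * K / (1 + t ^ 2)).
        rewrite Rabs_mult. unfold Rdiv. rewrite (Rmult_assoc (e * T)).
        apply Rmult_le_compat; auto using Rabs_pos; [|apply HK].
        rewrite Rabs_right by (specialize (exp_le_1 t Ht0); lra).
        pose proof (exp_ineq1_le (- e * t)). nra.
      + apply (is_RInt_minus (V := R_NormedModule)); apply continuous_is_RInt; [apply HK|apply cg].
      + apply is_RInt_cauchy.
    - rewrite atan_0. pose proof (atan_bound T).
      assert (0 <= e * T * K) by (apply Rmult_le_pos; [nra|auto]). nra. }
  assert (far : forall T', T <= T' -> Rabs (RInt g T T') <= K * (PI / 2 - atan T)).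
  { intros T' HT'. apply Rle_trans with (K * atan T' - K * atan T).
    - apply (norm_RInt_le (V := R_NormedModule) g (fun t => K / (1 + t ^ 2)) T T'); auto.
      + intros t [Ht0 Ht]. change (Rabs (g t) <= K / (1 + t ^ 2)). unfold g.
        rewrite Rabs_mult, Rabs_right by (left; apply exp_pos).
        assert (Ht1 : 0 <= t) by lra. specialize (exp_le_1 t Ht1).
        pose proof (proj2 HK t). pose proof (Rabs_pos (Cos_tr p t)). pose proof (exp_pos (- e * t)). nra.
      + apply continuous_is_RInt, cg.
      + apply is_RInt_cauchy.
    - pose proof (atan_bound T'). nra. }
  (* At the lower limit the primitive is minus the kernel; this is where the approximate identity
     appears. *)
  assert (E0 : Jint (fun u => p u * abel_prim e 0 u) = - Jint (fun u => p u * (e / (e ^ 2 + u ^ 2)))).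
  { assert (W : cauchy_dom (L * (e + / e)) (fun u => p u * (e / (e ^ 2 + u ^ 2)))).
    { apply cauchy_dom_mult; [apply abel_kernel_dom; auto|apply Hp|].
      apply cauchy_dom_bounded, moment_dom_cauchy; auto. }
    assert (E : forall u, -1 * (p u * (e / (e ^ 2 + u ^ 2))) = p u * abel_prim e 0 u).
    { intros u. pose proof (sq_sum_pos e u He). unfold abel_prim.
      rewrite Rmult_0_r, Rmult_0_l, exp_0, sin_0, cos_0. field. lra. }
    rewrite <- (Jint_ext _ _ _ (cauchy_dom_scal _ (-1) _ W) E), (Jint_scal _ _ _ W). ring. }
  apply le_epsilon. intros eps Heps.
  set (D := 2 / e * L * PI).
  assert (HD : 0 <= D).
  { unfold D. apply Rmult_le_pos; [apply Rmult_le_pos|]; try lra.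
    left; apply Rdiv_lt_0_compat; lra. }
  (* Far enough for the boundary term, at most [exp (- e * T') * D], to fall below [eps]; the
     inequality [exp x >= 1 + x] is enough for this. *)
  set (T' := Rmax T (D / eps / e)).
  assert (HT' : T <= T') by apply Rmax_l.
  assert (tail : Rabs (Jint (fun u => p u * abel_prim e T' u)) <= eps).
  { apply Rle_trans with (exp (- e * T') * (2 / e) * L * PI).
    - apply Jint_bound. apply moment_dom_bounded_mult; auto.
      + intros; apply continuous_abel_prim; auto.
      + intros; apply abel_prim_bound; auto.
    - replace (exp (- e * T') * (2 / e) * L * PI) with (exp (- e * T') * D) by (unfold D; ring).
      replace (- e * T') with (- (e * T')) by ring. rewrite exp_Ropp.
      assert (H1 : D / eps <= e * T').
      { rewrite Rmult_comm. apply (proj1 (Rle_div_l _ _ e He)). apply Rmax_r. }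
      pose proof (exp_ineq1_le (e * T')).
      rewrite Rmult_comm. apply (proj2 (Rle_div_l _ _ _ (exp_pos (e * T')))).
      apply (proj1 (Rle_div_l _ _ eps Heps)) in H1. nra. }
  pose proof (RInt_abel e L p T' He Hp) as E1. fold g in E1.
  assert (E2 : RInt g 0 T' = RInt g 0 T + RInt g T T').
  { rewrite <- (RInt_Chasles g 0 T T') by (apply continuous_ex_RInt, cg). reflexivity. }
  specialize (far T' HT').
  replace (RInt (Cos_tr p) 0 T - Jint (fun u => p u * (e / (e ^ 2 + u ^ 2)))) with
    ((RInt (Cos_tr p) 0 T - RInt g 0 T) + (- RInt g T T') + Jint (fun u => p u * abel_prim e T' u))
    by lra.
  eapply Rle_trans; [apply Rabs_triang|].
  apply Rplus_le_compat; [|exact tail].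
  eapply Rle_trans; [apply Rabs_triang|]. rewrite Rabs_Ropp. lra.
Qed.

Lemma cos_inversion_error L K p T : 0 <= T -> moment_dom L p -> cauchy_dom K (Cos_tr p) ->
  Rabs (RInt (Cos_tr p) 0 T - PI * p 0) <= K * (PI / 2 - atan T).
Proof.
  intros HT Hp HK. pose proof PI_RGT_0 as HPI. pose proof (cauchy_dom_nonneg _ _ HK) as HK0.
  apply le_epsilon. intros eps Heps.
  (* Half of [eps] pays for [eta] and half for the terms linear in [e]. The choice of [eta] comes
     first because [B], and hence [e], depends on it. *)
  assert (Heta : 0 < eps / (2 * PI)) by (apply Rdiv_lt_0_compat; lra).
  destruct (abel_kernel_approx p L (mkposreal _ Heta)) as [B [HB Happ]].
  { apply Hp. }
  { apply cauchy_dom_bounded, moment_dom_cauchy; auto. }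
  cbn [pos] in Happ.
  assert (HD : 0 < 2 * (T * K * (PI / 2) + B * PI + 1)).
  { assert (0 <= T * K * (PI / 2)) by (apply Rmult_le_pos; [apply Rmult_le_pos; auto|lra]).
    assert (0 <= B * PI) by (apply Rmult_le_pos; lra). lra. }
  set (e := eps / (2 * (T * K * (PI / 2) + B * PI + 1))).
  assert (He : 0 < e) by (apply Rdiv_lt_0_compat; auto).
  specialize (Happ e He). pose proof (abel_error e L K p T He HT Hp HK) as Herr.
  assert (Ee : e * (T * K * (PI / 2) + B * PI + 1) = eps / 2).
  { unfold e. field. lra. }
  assert (Ep : eps / (2 * PI) * PI = eps / 2) by (field; lra).
  replace (RInt (Cos_tr p) 0 T - PI * p 0) with
    ((RInt (Cos_tr p) 0 T - Jint (fun u => p u * (e / (e ^ 2 + u ^ 2)))) +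
     (Jint (fun u => p u * (e / (e ^ 2 + u ^ 2))) - PI * p 0)) by ring.
  eapply Rle_trans; [apply Rabs_triang|].
  rewrite Rmult_plus_distr_r, Ep in Happ. clearbody e. lra.
Qed.

Lemma RInt_reflect (h : R -> R) T : (forall u, continuous h u) ->
  RInt h (- T) 0 = RInt (fun u => h (- u)) 0 T.
Proof.
  intros Hc. symmetry. apply (is_RInt_unique (V := R_CompleteNormedModule)).
  pose proof (is_RInt_comp_opp (V := R_NormedModule) h 0 T (RInt h 0 (- T))) as I.
  rewrite Ropp_0 in I. specialize (I (continuous_is_RInt h 0 (- T) Hc)).
  apply (is_RInt_opp (V := R_NormedModule)) in I.
  rewrite <- (opp_RInt_swap (V := R_CompleteNormedModule) h) by (apply continuous_ex_RInt; auto).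
  apply (is_RInt_ext (V := R_NormedModule)) with (2 := I).
  intros x _. unfold opp; simpl. ring.
Qed.

(** The transform is even, so its integral over [[- T, T]] is twice the one over [[0, T]], which
    tends to [PI * p 0]. *)
Lemma Jint_Cos_tr L K p : moment_dom L p -> cauchy_dom K (Cos_tr p) ->
  Jint (Cos_tr p) = 2 * PI * p 0.
Proof.
  intros Hp HK. pose proof (Jint_lim_sym K _ HK) as H1.
  refine (filterlim_locally_unique (V := R_NormedModule) _ _ _ H1 _).
  apply (filterlim_ext (fun T => 2 * RInt (Cos_tr p) 0 T)).
  { intros T. rewrite <- (RInt_Chasles (Cos_tr p) (- T) 0 T) by (apply continuous_ex_RInt, HK).
    rewrite RInt_reflect by apply HK.
    rewrite (RInt_ext (fun u => Cos_tr p (- u)) (Cos_tr p)).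
    - unfold plus; simpl; ring.
    - intros t _. unfold Cos_tr. apply (Jint_ext L); [apply moment_dom_cos; auto|].
      intros u. rewrite Ropp_mult_distr_l_reverse, cos_neg. auto. }
  apply filterlim_locally. intros eps.
  pose proof (cauchy_dom_nonneg _ _ HK) as HK0. pose proof (cond_pos eps) as Heps.
  assert (He : 0 < eps / (2 * (K + 1))) by (apply Rdiv_lt_0_compat; lra).
  pose proof (proj1 (filterlim_locally _ _) is_lim_atan_p (mkposreal _ He)) as [M HM].
  exists (Rmax M 0). intros T HT. pose proof (Rmax_l M 0). pose proof (Rmax_r M 0).
  assert (HT0 : 0 <= T) by lra. assert (HTM : M < T) by lra.
  specialize (HM T HTM). apply ball_Rabs, Rabs_def2 in HM. simpl in HM.
  apply Rabs_ball.
  replace (2 * RInt (Cos_tr p) 0 T - 2 * PI * p 0) with (2 * (RInt (Cos_tr p) 0 T - PI * p 0)) by ring.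
  rewrite Rabs_mult, (Rabs_right 2) by lra.
  pose proof (cos_inversion_error L K p T HT0 Hp HK).
  assert (E : (K + 1) * (eps / (2 * (K + 1))) = eps / 2) by (field; lra).
  pose proof (atan_bound T). nra.
Qed.

(** The transform is odd, so every symmetric integral is 0. *)
Lemma Jint_Sin_tr L K p : moment_dom L p -> cauchy_dom K (Sin_tr p) -> Jint (Sin_tr p) = 0.
Proof.
  intros Hp HK. pose proof (Jint_lim_sym K _ HK) as H1.
  refine (filterlim_locally_unique (V := R_NormedModule) _ _ _ H1 _).
  apply (filterlim_ext (fun T => 0)); [|apply filterlim_const].
  intros T. rewrite <- (RInt_Chasles (Sin_tr p) (- T) 0 T) by (apply continuous_ex_RInt, HK).
  rewrite RInt_reflect by apply HK.
  rewrite (RInt_ext (fun u => Sin_tr p (- u)) (fun u => @opp R_CompleteNormedModule (Sin_tr p u))).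
  - rewrite (RInt_opp (V := R_CompleteNormedModule) (Sin_tr p)) by (apply continuous_ex_RInt, HK). unfold plus, opp; simpl; ring.
  - intros t _. unfold Sin_tr. unfold opp; simpl.
    replace (- Jint (fun u => p u * sin (t * u))) with (-1 * Jint (fun u => p u * sin (t * u))) by ring.
    rewrite <- (Jint_scal L) by (apply moment_dom_sin; auto).
    symmetry. apply (Jint_ext (Rabs (-1) * L)); [apply cauchy_dom_scal, moment_dom_sin; auto|].
    intros u. rewrite Ropp_mult_distr_l_reverse, sin_neg. ring.
Qed.

(** * Complex transforms *)

Definition smooth_dom (p : R -> R) : Prop :=
  exists (p1 p2 : R -> R) (L0 L1 L2 : R),
    moment_dom L0 p /\ moment_dom L1 p1 /\ moment_dom L2 p2 /\
    (forall u, is_derive p u (p1 u)) /\ (forall u, is_derive p1 u (p2 u)).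

Lemma smooth_dom_ext p q : (forall u, p u = q u) -> smooth_dom p -> smooth_dom q.
Proof.
  intros E (p1 & p2 & L0 & L1 & L2 & [c0 b0] & M1 & M2 & d0 & d1).
  exists p1, p2, L0, L1, L2. split; [split|split; [|split; [|split]]]; auto.
  - intros u. apply (continuous_ext _ _ _ E), c0.
  - intros u. rewrite <- E; auto.
  - intros u. apply (is_derive_ext _ _ _ _ E); auto.
Qed.

(** A Peetre-type inequality: writing [u] as [(u + v) - v], each factor of the weight is
    submultiplicative up to a constant. With [v = ln n] it is the source of the polynomial in
    [ln n]. *)
Lemma moment_weight_shift u v :
  (1 + Rabs u) * (1 + u ^ 2) <=
  2 * ((1 + Rabs v) * (1 + v ^ 2)) * ((1 + Rabs (u + v)) * (1 + (u + v) ^ 2)).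
Proof.
  pose proof (Rabs_pos u). pose proof (Rabs_pos v). pose proof (Rabs_pos (u + v)).
  assert (H2 : Rabs u <= Rabs (u + v) + Rabs v).
  { replace u with ((u + v) + (- v)) at 1 by ring. eapply Rle_trans; [apply Rabs_triang|].
    rewrite Rabs_Ropp; lra. }
  assert (H3 : 1 + Rabs u <= (1 + Rabs v) * (1 + Rabs (u + v))) by nra.
  assert (H4 : 1 + u ^ 2 <= 2 * ((1 + v ^ 2) * (1 + (u + v) ^ 2))).
  { set (w := u + v). replace u with (w - v) by (unfold w; ring).
    assert (0 <= (w + v) ^ 2) by apply pow2_ge_0. assert (0 <= v ^ 2 * w ^ 2) by (apply Rmult_le_pos; apply pow2_ge_0).
    nra. }
  pose proof (one_sq_pos u).
  apply Rle_trans with ((1 + Rabs v) * (1 + Rabs (u + v)) * (2 * ((1 + v ^ 2) * (1 + (u + v) ^ 2)))).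
  - apply Rmult_le_compat; lra.
  - right; ring.
Qed.

Lemma moment_dom_shift L p v : moment_dom L p ->
  moment_dom (2 * ((1 + Rabs v) * (1 + v ^ 2)) * L) (fun u => p (u + v)).
Proof.
  intros [Hc Hb]; split.
  - intros u. apply (continuous_comp (fun u => u + v) p); [cont_by_derive|apply Hc].
  - intros u. specialize (Hb (u + v)). pose proof (one_sq_pos u). pose proof (one_sq_pos (u + v)).
    apply (proj2 (Rle_div_r _ _ _ H0)) in Hb. apply (proj1 (Rle_div_r _ _ _ H)).
    pose proof (moment_weight_shift u v) as W.
    pose proof (Rabs_pos (p (u + v))).
    apply Rle_trans with (Rabs (p (u + v)) *
      (2 * ((1 + Rabs v) * (1 + v ^ 2)) * ((1 + Rabs (u + v)) * (1 + (u + v) ^ 2)))).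
    + rewrite Rmult_assoc. apply Rmult_le_compat_l; auto.
    + replace (Rabs (p (u + v)) * (2 * ((1 + Rabs v) * (1 + v ^ 2)) * ((1 + Rabs (u + v)) * (1 + (u + v) ^ 2))))
        with (2 * ((1 + Rabs v) * (1 + v ^ 2)) * (Rabs (p (u + v)) * (1 + Rabs (u + v)) * (1 + (u + v) ^ 2))) by ring.
      apply Rmult_le_compat_l; auto. pose proof (Rabs_pos v). pose proof (one_sq_pos v).
      apply Rmult_le_pos; [lra|]. apply Rmult_le_pos; lra.
Qed.

Lemma is_derive_shift (p : R -> R) (u v l : R) : is_derive p (u + v) l ->
  is_derive (fun w => p (w + v)) u l.
Proof.
  intros H. evar_last.
  - apply (is_derive_comp (V := R_NormedModule) p (fun w => w + v) u l 1); [exact H|].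
    auto_derive; auto.
  - unfold scal; simpl; unfold mult; simpl. ring.
Qed.

Lemma smooth_dom_shift p v : smooth_dom p -> smooth_dom (fun u => p (u + v)).
Proof.
  intros (p1 & p2 & L0 & L1 & L2 & H0 & H1 & H2 & D0 & D1).
  exists (fun u => p1 (u + v)), (fun u => p2 (u + v)).
  do 3 eexists. split; [|split; [|split; [|split]]].
  1-3: apply moment_dom_shift; eassumption.
  all: intros u; apply is_derive_shift; auto.
Qed.

Lemma smooth_dom_tr p : smooth_dom p -> exists K, cauchy_dom K (Cos_tr p) /\ cauchy_dom K (Sin_tr p).
Proof.
  intros (p1 & p2 & L0 & L1 & L2 & H0 & H1 & H2 & D0 & D1).
  eexists. apply (tr_decay L0 L1 L2 p p1 p2); auto.
Qed.

Definition Cdom (K : R) (h : R -> C) : Prop :=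
  cauchy_dom K (fun u => Re (h u)) /\ cauchy_dom K (fun u => Im (h u)).

Definition CJ (h : R -> C) : C := (Jint (fun u => Re (h u)), Jint (fun u => Im (h u))).

Lemma is_CInt_gen_pair (h : R -> C) (Fa Fb : (R -> Prop) -> Prop) (l1 l2 : R) :
  Filter Fa -> Filter Fb ->
  is_RInt_gen (fun u => Re (h u)) Fa Fb l1 -> is_RInt_gen (fun u => Im (h u)) Fa Fb l2 ->
  is_CInt_gen h Fa Fb (l1, l2).
Proof.
  intros HFa HFb H1 H2 P [eps HP].
  assert (B1 : locally l1 (fun y => ball l1 eps y)) by (exists eps; auto).
  assert (B2 : locally l2 (fun y => ball l2 eps y)) by (exists eps; auto).
  pose proof (H1 _ B1) as A1. pose proof (H2 _ B2) as A2. unfold filtermapi in *.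
  pose proof (filter_and (F := filter_prod Fa Fb) _ _ A1 A2) as H.
  apply (filter_imp (F := filter_prod Fa Fb)) with (2 := H).
  intros ab [[y1 [I1 b1]] [y2 [I2 b2]]]. exists (y1, y2). split.
  - exact (is_RInt_fct_extend_pair (U := R_NormedModule) (V := R_NormedModule) h _ _ y1 y2 I1 I2).
  - apply HP. split; assumption.
Qed.

Lemma Cdom_is K h : Cdom K h -> is_CInt_gen h minf pinf (CJ h).
Proof.
  intros [H1 H2]. apply is_CInt_gen_pair; try apply Rbar_locally_filter.
  - apply (cauchy_dom_is K); auto.
  - apply (cauchy_dom_is K); auto.
Qed.

Lemma Cdom_ext K f g : (forall u, f u = g u) -> Cdom K f -> Cdom K g.
Proof.
  intros E [H1 H2]; split; [apply (cauchy_dom_ext K (fun u => Re (f u)))|apply (cauchy_dom_ext K (fun u => Im (f u)))];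
    auto; intros u; rewrite E; auto.
Qed.

Lemma CJ_ext K f g : Cdom K f -> (forall u, f u = g u) -> CJ f = CJ g.
Proof.
  intros [H1 H2] E. unfold CJ. f_equal; apply (Jint_ext K); auto; intros u; rewrite E; auto.
Qed.

Lemma Cdom_Cmod K h : Cdom K h -> cauchy_dom (K + K) (fun u => Cmod (h u)).
Proof.
  intros [[c1 b1] [c2 b2]]; split.
  - intros u.
    apply (continuous_ext (fun v => sqrt (Re (h v) * Re (h v) + Im (h v) * Im (h v)))).
    { intros v. unfold Cmod, Re, Im. f_equal. ring. }
    apply (continuous_comp (fun v => Re (h v) * Re (h v) + Im (h v) * Im (h v)) sqrt).
    + apply Rcontinuous_plus.
      * apply (Rcontinuous_mult _ _ u (c1 u) (c1 u)).
      * apply (Rcontinuous_mult _ _ u (c2 u) (c2 u)).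
    + apply continuous_sqrt.
  - intros u. rewrite Rabs_right by apply Rle_ge, Cmod_ge_0.
    apply Rle_trans with (Rabs (Re (h u)) + Rabs (Im (h u))).
    + unfold Cmod. rewrite <- (sqrt_pow2 (Rabs (Re (h u)) + Rabs (Im (h u)))).
      * apply sqrt_le_1_alt. rewrite <- (pow2_abs (fst _)), <- (pow2_abs (snd _)).
        pose proof (Rabs_pos (fst (h u))). pose proof (Rabs_pos (snd (h u))). unfold Re, Im. nra.
      * pose proof (Rabs_pos (Re (h u))). pose proof (Rabs_pos (Im (h u))). lra.
    + specialize (b1 u). specialize (b2 u). unfold Rdiv in *. rewrite Rmult_plus_distr_r. lra.
Qed.

Lemma Rabs_Re_le z : Rabs (Re z) <= Cmod z.
Proof. eapply Rle_trans; [apply Rmax_l|apply Rmax_Cmod]. Qed.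

Lemma Rabs_Im_le z : Rabs (Im z) <= Cmod z.
Proof. eapply Rle_trans; [apply Rmax_r|apply Rmax_Cmod]. Qed.

Lemma Cdom_mult K B (g h : R -> C) : Cdom K h ->
  (forall u, continuous (fun v => Re (g v)) u) -> (forall u, continuous (fun v => Im (g v)) u) ->
  (forall u, Cmod (g u) <= B) -> Cdom (B * K + B * K) (fun u => (g u * h u)%C).
Proof.
  intros [H1 H2] g1 g2 HB.
  assert (B1 : forall u, Rabs (Re (g u)) <= B) by (intros; eapply Rle_trans; [apply Rabs_Re_le|auto]).
  assert (B2 : forall u, Rabs (Im (g u)) <= B) by (intros; eapply Rle_trans; [apply Rabs_Im_le|auto]).
  split.
  - apply (cauchy_dom_minus _ _ _ _ (cauchy_dom_mult K B _ _ H1 g1 B1) (cauchy_dom_mult K B _ _ H2 g2 B2)).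
  - apply (cauchy_dom_plus _ _ _ _ (cauchy_dom_mult K B _ _ H2 g1 B1) (cauchy_dom_mult K B _ _ H1 g2 B2)).
Qed.

Lemma Cdom_scal K c h : Cdom K h -> Cdom (Cmod c * K + Cmod c * K) (fun u => (c * h u)%C).
Proof.
  intros H. apply (Cdom_mult K (Cmod c) (fun _ => c)); auto; intros; try apply continuous_const.
  lra.
Qed.

Lemma CJ_scal K c h : Cdom K h -> CJ (fun u => (c * h u)%C) = (c * CJ h)%C.
Proof.
  intros [H1 H2]. unfold CJ, Cmult; simpl. f_equal.
  - rewrite (Jint_minus (Rabs (fst c) * K) (Rabs (snd c) * K)) by (apply cauchy_dom_scal; auto).
    rewrite !(Jint_scal K) by auto. reflexivity.
  - rewrite (Jint_plus (Rabs (fst c) * K) (Rabs (snd c) * K)) by (apply cauchy_dom_scal; auto).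
    rewrite !(Jint_scal K) by auto. reflexivity.
Qed.

Lemma CJ_shift K K' h a : Cdom K h -> Cdom K' (fun u => h (u + a)) -> CJ (fun u => h (u + a)) = CJ h.
Proof.
  intros [H1 H2] [H3 H4]. unfold CJ. f_equal.
  - apply (Jint_shift K K' (fun u => Re (h u)) a); auto.
  - apply (Jint_shift K K' (fun u => Im (h u)) a); auto.
Qed.

Lemma ex_series_Cmod_parts (a : nat -> C) : ex_series (fun n => Cmod (a n)) ->
  ex_series (fun n => Re (a n)) /\ ex_series (fun n => Im (a n)).
Proof.
  intros H; split.
  - apply (ex_series_le (V := R_CompleteNormedModule) _ _ (fun n => Rabs_Re_le (a n)) H).
  - apply (ex_series_le (V := R_CompleteNormedModule) _ _ (fun n => Rabs_Im_le (a n)) H).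
Qed.

Lemma Rex_series_scal (r : R) (b : nat -> R) : ex_series b -> ex_series (fun n => r * b n).
Proof. exact (ex_series_scal_l r b). Qed.

Lemma CSeries_scal (c : C) (a : nat -> C) : ex_series (fun n => Cmod (a n)) ->
  CSeries (fun n => (c * a n)%C) = (c * CSeries a)%C.
Proof.
  intros H. destruct (ex_series_Cmod_parts a H) as [H1 H2].
  unfold CSeries, Cmult; simpl. f_equal.
  - rewrite (Series_minus (fun n => fst c * fst (a n)) (fun n => snd c * snd (a n))) by (apply Rex_series_scal; auto).
    rewrite !Series_scal_l. reflexivity.
  - rewrite (Series_plus (fun n => fst c * snd (a n)) (fun n => snd c * fst (a n))) by (apply Rex_series_scal; auto).
    rewrite !Series_scal_l. reflexivity.
Qed.

Lemma CSeries_ext (a b : nat -> C) : (forall n, a n = b n) -> CSeries a = CSeries b.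
Proof.
  intros E. unfold CSeries. f_equal; apply Series_ext; intros n; rewrite E; auto.
Qed.

Lemma Cdom_series (h : nat -> R -> C) (M : nat -> R) :
  (forall n, Cdom (M n) (h n)) -> ex_series M ->
  Cdom (Series M) (fun u => CSeries (fun n => h n u)) /\
  CJ (fun u => CSeries (fun n => h n u)) = CSeries (fun n => CJ (h n)).
Proof.
  intros H HM.
  destruct (cauchy_dom_series (fun n u => Re (h n u)) M (fun n => proj1 (H n)) HM) as [_ [D1 S1]].
  destruct (cauchy_dom_series (fun n u => Im (h n u)) M (fun n => proj2 (H n)) HM) as [_ [D2 S2]].
  split; [split; auto|].
  unfold CJ, CSeries; simpl. f_equal; symmetry; apply is_series_unique; auto.
Qed.

Definition cis (x : R) : C := (cos x, sin x).

Lemma cis_plus x y : cis (x + y) = (cis x * cis y)%C.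
Proof. unfold cis, Cmult; simpl. rewrite cos_plus, sin_plus. f_equal; ring. Qed.

Lemma Cmod_cis x : Cmod (cis x) = 1.
Proof.
  unfold Cmod, cis; simpl. rewrite !Rmult_1_r. pose proof (sin2_cos2 x) as E. unfold Rsqr in E.
  replace (cos x * cos x + sin x * sin x) with 1 by lra. apply sqrt_1.
Qed.

Lemma cis_0 : cis 0 = 1%C.
Proof. unfold cis. rewrite cos_0, sin_0. reflexivity. Qed.

Definition Csmooth (P : R -> C) : Prop :=
  smooth_dom (fun u => Re (P u)) /\ smooth_dom (fun u => Im (P u)).

(** With [x = exp u], the factor [cis (t * u)] is the oscillating part of [cpow x s] when
    [Im s = t]; hence the positive sign. *)
Definition Ftr (P : R -> C) (t : R) : C := CJ (fun u => (P u * cis (t * u))%C).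

Lemma Csmooth_shift P v : Csmooth P -> Csmooth (fun u => P (u + v)).
Proof.
  intros [H1 H2]; split.
  - apply (smooth_dom_shift (fun u => Re (P u))); auto.
  - apply (smooth_dom_shift (fun u => Im (P u))); auto.
Qed.

Lemma Cdom_cis L L' P t : moment_dom L (fun u => Re (P u)) -> moment_dom L' (fun u => Im (P u)) ->
  Cdom (L + L') (fun u => (P u * cis (t * u))%C).
Proof.
  intros H1 H2; split; unfold Cmult; simpl.
  - apply (cauchy_dom_minus L L' (fun u => Re (P u) * cos (t * u)) (fun u => Im (P u) * sin (t * u))).
    + apply moment_dom_cos; auto.
    + apply moment_dom_sin; auto.
  - apply (cauchy_dom_plus L L' (fun u => Re (P u) * sin (t * u)) (fun u => Im (P u) * cos (t * u))).
    + apply moment_dom_sin; auto.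
    + apply moment_dom_cos; auto.
Qed.

Lemma Ftr_parts L L' P t : moment_dom L (fun u => Re (P u)) -> moment_dom L' (fun u => Im (P u)) ->
  Ftr P t = (Cos_tr (fun u => Re (P u)) t - Sin_tr (fun u => Im (P u)) t,
             Sin_tr (fun u => Re (P u)) t + Cos_tr (fun u => Im (P u)) t).
Proof.
  intros H1 H2. unfold Ftr, CJ, Cmult, Cos_tr, Sin_tr; simpl. f_equal.
  - apply (Jint_minus L L' (fun u => Re (P u) * cos (t * u)) (fun u => Im (P u) * sin (t * u))).
    + apply moment_dom_cos; auto.
    + apply moment_dom_sin; auto.
  - apply (Jint_plus L L' (fun u => Re (P u) * sin (t * u)) (fun u => Im (P u) * cos (t * u))).
    + apply moment_dom_sin; auto.
    + apply moment_dom_cos; auto.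
Qed.

(** When [Ftr P] is integrated over [t], the sine transforms drop out by oddness, leaving the cosine
    transforms of the two parts. *)
Lemma Ftr_dom P : Csmooth P -> exists K, Cdom K (Ftr P) /\ CJ (Ftr P) = (RtoC (2 * PI) * P 0)%C.
Proof.
  intros [H1 H2].
  destruct (smooth_dom_tr _ H1) as [K1 [C1 S1]]. destruct (smooth_dom_tr _ H2) as [K2 [C2 S2]].
  destruct H1 as (_ & _ & L & _ & _ & H1 & _). destruct H2 as (_ & _ & L' & _ & _ & H2 & _).
  set (G := fun t => (Cos_tr (fun u => Re (P u)) t - Sin_tr (fun u => Im (P u)) t,
             Sin_tr (fun u => Re (P u)) t + Cos_tr (fun u => Im (P u)) t) : C).
  assert (E : forall t, G t = Ftr P t) by (intros t; symmetry; apply (Ftr_parts L L'); auto).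
  assert (D : Cdom (K1 + K2) G).
  { split.
    - exact (cauchy_dom_minus _ _ _ _ C1 S2).
    - exact (cauchy_dom_plus _ _ _ _ S1 C2). }
  exists (K1 + K2). split.
  - apply (Cdom_ext _ G); auto.
  - rewrite <- (CJ_ext _ G (Ftr P) D E). unfold CJ, Cmult, RtoC; simpl. f_equal.
    + rewrite (Jint_minus _ _ _ _ C1 S2), (Jint_Cos_tr L _ _ H1 C1), (Jint_Sin_tr L' _ _ H2 S2).
      unfold Re; ring.
    + rewrite (Jint_plus _ _ _ _ S1 C2), (Jint_Cos_tr L' _ _ H2 C2), (Jint_Sin_tr L _ _ H1 S1).
      unfold Im; ring.
Qed.

Lemma Ftr_shift P v t : Csmooth P -> Ftr (fun u => P (u + v)) t = (cis (- t * v) * Ftr P t)%C.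
Proof.
  intros HP. pose proof (Csmooth_shift P v HP) as HPv.
  destruct HP as [(_ & _ & L & _ & _ & H1 & _) (_ & _ & L' & _ & _ & H2 & _)].
  destruct HPv as [(_ & _ & M & _ & _ & H3 & _) (_ & _ & M' & _ & _ & H4 & _)].
  pose proof (Cdom_cis L L' P t H1 H2) as D.
  pose proof (Cdom_cis M M' (fun u => P (u + v)) t H3 H4) as Dv.
  pose proof (Cdom_scal _ (cis (- t * v)) _ D) as Ds.
  set (h := fun u => (cis (- t * v) * (P u * cis (t * u)))%C).
  assert (E : forall u, (P (u + v)%R * cis (t * u))%C = h (u + v)%R).
  { intros u. unfold h. replace (t * u) with (- t * v + t * (u + v)) by ring.
    rewrite cis_plus. ring. }
  unfold Ftr. rewrite (CJ_ext _ _ _ Dv E).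
  rewrite (CJ_shift _ _ h v Ds (Cdom_ext _ _ _ E Dv)).
  apply (CJ_scal _ _ _ D).
Qed.

(** Multiplying the transform by this phase is translating [P] by [v], so the inversion at the
    origin applies to the translate. *)
Lemma Ftr_inversion P v : Csmooth P ->
  CJ (fun t => (cis (- t * v) * Ftr P t)%C) = (RtoC (2 * PI) * P v)%C.
Proof.
  intros HP. destruct (Ftr_dom _ (Csmooth_shift P v HP)) as [K [D E]].
  rewrite Rplus_0_l in E. rewrite <- E. symmetry.
  apply (CJ_ext K); auto. intros t. apply Ftr_shift; auto.
Qed.

Lemma Cdom_twist K v F : Cdom K F -> Cdom (K + K) (fun t => (cis (- t * v) * F t)%C).
Proof.
  intros H. rewrite <- (Rmult_1_l K). apply (Cdom_mult K 1 (fun t => cis (- t * v))); auto.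
  - intros u. unfold cis; simpl. cont_by_derive.
  - intros u. unfold cis; simpl. cont_by_derive.
  - intros u. rewrite Cmod_cis. lra.
Qed.

(** * From the class M to the line *)

Lemma exp_weight d : 0 < d ->
  exists W, 0 <= W /\ forall u, (1 + Rabs u) * (1 + u ^ 2) * exp (- d * Rabs u) <= W.
Proof.
  (* For [a = Rabs u], [exp (d * a)] is the cube of [exp (d / 3 * a) >= 1 + d / 3 * a >= q * (1 +
     a)], and the cube of [1 + a] covers the weight. *)
  intros Hd. set (q := Rmin 1 (d / 3)).
  assert (Hq : 0 < q) by (apply Rmin_glb_lt; lra).
  assert (Hq1 : q <= 1) by apply Rmin_l. assert (Hq2 : q <= d / 3) by apply Rmin_r.
  assert (Hq3 : 0 < q ^ 3) by (apply pow_lt; auto).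
  exists (/ q ^ 3). split; [left; apply Rinv_0_lt_compat; auto|].
  intros u. rewrite <- (pow2_abs u). pose proof (Rabs_pos u). set (a := Rabs u) in *.
  replace (- d * a) with (- (d * a)) by ring. rewrite exp_Ropp.
  apply (proj2 (Rle_div_l _ _ _ (exp_pos (d * a)))).
  assert (E : (q * (1 + a)) ^ 3 <= exp (d * a)).
  { replace (exp (d * a)) with (exp (d / 3 * a) ^ 3).
    - apply pow_incr. split; [nra|].
      pose proof (exp_ineq1_le (d / 3 * a)). nra.
    - simpl. rewrite Rmult_1_r, <- !exp_plus. f_equal. field. }
  apply Rle_trans with (/ q ^ 3 * (q * (1 + a)) ^ 3).
  - replace (/ q ^ 3 * (q * (1 + a)) ^ 3) with ((1 + a) ^ 3) by (field; lra). nra.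
  - apply Rmult_le_compat_l; auto. left; apply Rinv_0_lt_compat; auto.
Qed.

Lemma moment_dom_exp d K p : 0 < d -> (forall u, continuous p u) ->
  (forall u, Rabs (p u) <= K * exp (- d * Rabs u)) -> exists L, moment_dom L p.
Proof.
  intros Hd Hc Hb. destruct (exp_weight d Hd) as [W [HW0 HW]].
  assert (HK : 0 <= K).
  { specialize (Hb 0). rewrite Rabs_R0, Rmult_0_r, exp_0 in Hb. pose proof (Rabs_pos (p 0)). lra. }
  exists (K * W). split; auto. intros u. specialize (Hb u). specialize (HW u).
  pose proof (one_sq_pos u) as H1. pose proof (Rabs_pos u).
  apply (proj1 (Rle_div_r _ _ _ H1)).
  apply Rle_trans with (K * exp (- d * Rabs u) * ((1 + Rabs u) * (1 + u ^ 2))).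
  - rewrite Rmult_assoc. apply Rmult_le_compat_r; auto. apply Rmult_le_pos; lra.
  - rewrite Rmult_assoc, (Rmult_comm (exp _)). apply Rmult_le_compat_l; auto.
Qed.

Lemma moment_dom_plus L L' p q : moment_dom L p -> moment_dom L' q ->
  moment_dom (L + L') (fun u => p u + q u).
Proof.
  intros [H1 H2] [H3 H4]; split.
  - intros u; apply Rcontinuous_plus; auto.
  - intros u. specialize (H2 u). specialize (H4 u). unfold Rdiv in *. rewrite Rmult_plus_distr_r.
    pose proof (Rabs_triang (p u) (q u)). pose proof (Rabs_pos u).
    apply Rle_trans with ((Rabs (p u) + Rabs (q u)) * (1 + Rabs u)); [|lra].
    apply Rmult_le_compat_r; lra.
Qed.

Lemma moment_dom_scal L c p : moment_dom L p -> moment_dom (Rabs c * L) (fun u => c * p u).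
Proof.
  intros [H1 H2]; split.
  - intros u. apply (Rcontinuous_mult (fun _ => c)); auto. apply continuous_const.
  - intros u. rewrite Rabs_mult. unfold Rdiv. rewrite !Rmult_assoc.
    apply Rmult_le_compat_l; auto using Rabs_pos.
Qed.

(** The bound is uniform over the closed range of [r], so that a [sigma] strictly inside can be
    compared with exponents on either side. The shift [j] matches the extra power of [x] that the
    [j]-th derivative can absorb. *)
Definition strip_bdd (alpha j : R) (h : R -> R) : Prop :=
  (forall u, continuous (fun v => h (exp v)) u) /\
  exists K, forall r u, 1 <= r <= alpha -> Rabs (h (exp u)) * exp ((r + j) * u) <= K.

Lemma continuous_exp_lin r u : continuous (fun v => exp (r * v)) u.
Proof. cont_by_derive. Qed.

Lemma strip_bdd_moment alpha j h sigma : 1 < sigma < alpha -> strip_bdd alpha j h ->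
  exists L, moment_dom L (fun u => h (exp u) * exp ((sigma + j) * u)).
Proof.
  intros Hs [Hc [K HK]].
  set (d := Rmin (sigma - 1) (alpha - sigma)).
  assert (Hd : 0 < d) by (apply Rmin_glb_lt; lra).
  apply (moment_dom_exp d K); auto.
  - intros u. apply Rcontinuous_mult; auto. apply continuous_exp_lin.
  - intros u.
    assert (Hd1 : d <= sigma - 1) by apply Rmin_l. assert (Hd2 : d <= alpha - sigma) by apply Rmin_r.
    (* A larger exponent for [u >= 0] and a smaller one for [u < 0] gain [exp (- d * Rabs u)] in
       both directions. *)
    assert (Hr : exists r, 1 <= r <= alpha /\ (sigma - r) * u = - d * Rabs u).
    { destruct (Rle_lt_dec 0 u).
      - exists (sigma + d). rewrite Rabs_right by lra. split; [lra|ring].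
      - exists (sigma - d). rewrite Rabs_left by lra. split; [lra|ring]. }
    destruct Hr as [r [Hr1 Hr2]]. specialize (HK r u Hr1).
    rewrite <- Hr2, Rabs_mult, (Rabs_right (exp _)) by (left; apply exp_pos).
    replace ((sigma + j) * u) with ((r + j) * u + (sigma - r) * u) by ring.
    rewrite exp_plus, <- Rmult_assoc. apply Rmult_le_compat_r; auto. left; apply exp_pos.
Qed.

Lemma is_derive_exp_weight (a : R -> R) (r u l : R) : is_derive a (exp u) l ->
  is_derive (fun v => a (exp v) * exp (r * v)) u (r * (a (exp u) * exp (r * u)) + l * exp ((r + 1) * u)).
Proof.
  intros H. evar_last.
  - apply (Ris_derive_mult (fun v => a (exp v)) (fun v => exp (r * v)) u (l * exp u) (r * exp (r * u))).
    + evar_last.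
      * apply (is_derive_comp (V := R_NormedModule) a exp u l (exp u)); [exact H|apply is_derive_exp].
      * unfold scal; simpl; unfold mult; simpl. ring.
    + auto_derive; auto. ring.
  - replace ((r + 1) * u) with (r * u + u) by ring. rewrite exp_plus. ring.
Qed.

(** Differentiating [a (exp u) * exp (r * u)] gives [r] times itself plus the same expression with
    the derivative of [a] and [r + 1]: the chain rule factor [exp u] raises the exponent in step
    with [j]. *)
Lemma strip_smooth alpha sigma a0 a1 a2 : 1 < sigma < alpha ->
  strip_bdd alpha 0 a0 -> strip_bdd alpha 1 a1 -> strip_bdd alpha 2 a2 ->
  (forall x, 0 < x -> is_derive a0 x (a1 x)) -> (forall x, 0 < x -> is_derive a1 x (a2 x)) ->
  smooth_dom (fun u => a0 (exp u) * exp (sigma * u)).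
Proof.
  intros Hs B0 B1 B2 D0 D1.
  destruct (strip_bdd_moment _ _ _ _ Hs B0) as [L0 M0].
  destruct (strip_bdd_moment _ _ _ _ Hs B1) as [L1 M1].
  destruct (strip_bdd_moment _ _ _ _ Hs B2) as [L2 M2].
  rewrite Rplus_0_r in M0.
  set (p0 := fun u => a0 (exp u) * exp (sigma * u)) in *.
  set (p1 := fun u => a1 (exp u) * exp ((sigma + 1) * u)) in *.
  set (p2 := fun u => a2 (exp u) * exp ((sigma + 2) * u)) in *.
  assert (d0 : forall u, is_derive p0 u (sigma * p0 u + p1 u)).
  { intros u. apply (is_derive_exp_weight a0 sigma u (a1 (exp u))). apply D0, exp_pos. }
  assert (d1 : forall u, is_derive p1 u ((sigma + 1) * p1 u + p2 u)).
  { intros u. unfold p1, p2. replace (sigma + 2) with (sigma + 1 + 1) by ring.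
    apply (is_derive_exp_weight a1 (sigma + 1) u (a2 (exp u))). apply D1, exp_pos. }
  pose proof (moment_dom_plus _ _ _ _ (moment_dom_scal _ sigma _ M0) M1) as N1.
  pose proof (moment_dom_plus _ _ _ _ (moment_dom_scal _ (sigma + 1) _ M1) M2) as N2.
  exists (fun u => sigma * p0 u + p1 u), (fun u => sigma * (sigma * p0 u + p1 u) + ((sigma + 1) * p1 u + p2 u)).
  exists L0. do 2 eexists. split; [exact M0|split; [exact N1|split; [|split; [exact d0|]]]].
  - exact (moment_dom_plus _ _ _ _ (moment_dom_scal _ sigma _ N1) N2).
  - intros u. apply (is_derive_plus (V := R_NormedModule) (fun u => sigma * p0 u) p1); auto.
    apply (is_derive_scal p0 u sigma); auto.
Qed.

(** The bound at infinity handles large arguments and compactness the others. Composing with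
    [Rmax 0] extends [h] from the half-line to all reals, so that continuity can be two-sided. *)
Lemma strip_bdd_intro alpha j h M c : 0 <= j -> (forall x, continuous (fun y => h (Rmax 0 y)) x) ->
  (forall x, M <= x -> Rabs (h x) <= c * Rpower x (- alpha - j)) -> strip_bdd alpha j h.
Proof.
  intros Hj Hc HM.
  assert (Hmax : forall u, Rmax 0 (exp u) = exp u) by (intros u; apply Rmax_right; left; apply exp_pos).
  split.
  - intros u. apply (continuous_ext (fun v => h (Rmax 0 (exp v)))); [intros v; rewrite Hmax; auto|].
    apply (continuous_comp exp (fun y => h (Rmax 0 y))); auto.
    apply (is_derive_Rcontinuous _ _ _ (is_derive_exp u)).
  (* [N >= 1] makes [ln N] nonnegative, so that below [N] the exponent [(r + j) * u] is at most
     [(alpha + j) * ln N] for all [r] at once. *)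
  - set (N := Rmax M 1). assert (HN1 : 1 <= N) by apply Rmax_r. assert (HN2 : M <= N) by apply Rmax_l.
    destruct (continuity_ab_maj (fun y => Rabs (h (Rmax 0 y))) 0 N) as [m [Hm _]]; [lra| |].
    { intros x _. apply continuity_pt_filterlim.
      apply (continuous_comp (fun y => h (Rmax 0 y)) Rabs); auto. apply continuous_Rabs. }
    set (B := Rabs (h (Rmax 0 m))) in *.
    assert (HlN : 0 <= ln N).
    { rewrite <- ln_1. destruct (Rle_lt_or_eq_dec 1 N HN1) as [E|E].
      - left; apply ln_increasing; lra.
      - rewrite <- E; right; auto. }
    exists (Rmax (Rabs c) (B * exp ((alpha + j) * ln N))).
    intros r u Hr. destruct (Rle_lt_dec N (exp u)) as [Hu|Hu].
    + eapply Rle_trans; [|apply Rmax_l].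
      assert (Hu0 : 0 <= u).
      { destruct (Rle_lt_dec 0 u); auto. pose proof (exp_increasing u 0 r0). rewrite exp_0 in *. lra. }
      assert (HMu : M <= exp u) by lra. specialize (HM (exp u) HMu).
      unfold Rpower in HM. rewrite ln_exp in HM.
      apply Rle_trans with (Rabs c * exp ((- alpha - j) * u) * exp ((r + j) * u)).
      * apply Rmult_le_compat_r; [left; apply exp_pos|]. eapply Rle_trans; [exact HM|].
        apply Rmult_le_compat_r; [left; apply exp_pos|apply Rle_abs].
      * rewrite Rmult_assoc, <- exp_plus. rewrite <- (Rmult_1_r (Rabs c)) at 2.
        apply Rmult_le_compat_l; [apply Rabs_pos|]. rewrite <- exp_0.
        replace ((- alpha - j) * u + (r + j) * u) with (- ((alpha - r) * u)) by ring.
        assert (H : 0 <= (alpha - r) * u) by (apply Rmult_le_pos; lra).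
        destruct (Rle_lt_or_eq_dec _ _ H) as [H'|H'].
        -- left; apply exp_increasing; lra.
        -- rewrite <- H', Ropp_0; right; auto.
    + eapply Rle_trans; [|apply Rmax_r].
      assert (Hb : Rabs (h (exp u)) <= B).
      { rewrite <- Hmax. apply Hm. pose proof (exp_pos u). lra. }
      apply Rmult_le_compat; auto using Rabs_pos; [left; apply exp_pos|].
      assert (Hul : u < ln N). { rewrite <- (ln_exp u). apply ln_increasing; auto using exp_pos. }
      assert (E : (r + j) * u <= (alpha + j) * ln N).
      { apply Rle_trans with ((r + j) * ln N); [apply Rmult_le_compat_l; lra|].
        apply Rmult_le_compat_r; lra. }
      destruct (Rle_lt_or_eq_dec _ _ E) as [H'|H'].
      * left; apply exp_increasing; auto.
      * rewrite H'; right; auto.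
Qed.

(** Abstracts [Re] and [Im], so that the passage from complex to real regularity is proved once for
    both. *)
Definition real_part_like (pr : C -> R) : Prop :=
  (forall z : C, filterlim pr (locally z) (locally (pr z))) /\
  (forall z, Rabs (pr z) <= Cmod z) /\
  (forall z w r, r <> 0 -> pr ((z - w) / RtoC r)%C = (pr z - pr w) / r).

Lemma real_part_like_Re : real_part_like Re.
Proof.
  split; [|split].
  - intros z. apply (continuous_fst (U := R_UniformSpace) (V := R_UniformSpace)).
  - apply Rabs_Re_le.
  - intros [a b] [c d] r Hr. unfold Re, Cdiv, Cinv, Cminus, Cplus, Copp, Cmult, RtoC; simpl.
    field; auto.
Qed.

Lemma real_part_like_Im : real_part_like Im.
Proof.
  split; [|split].
  - intros z. apply (continuous_snd (U := R_UniformSpace) (V := R_UniformSpace)).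
  - apply Rabs_Im_le.
  - intros [a b] [c d] r Hr. unfold Im, Cdiv, Cinv, Cminus, Cplus, Copp, Cmult, RtoC; simpl.
    field; auto.
Qed.

Lemma cont_on_nonneg_part pr g : real_part_like pr -> cont_on_nonneg g ->
  forall x, continuous (fun y => pr (g (Rmax 0 y))) x.
Proof.
  intros [Hpr _] Hg x. unfold continuous.
  apply (filterlim_comp _ _ _ (fun y => g (Rmax 0 y)) pr _ (locally (g (Rmax 0 x)))); [|apply Hpr].
  apply (filterlim_comp _ _ _ (Rmax 0) g _ (within (fun y => 0 <= y) (locally (Rmax 0 x)))).
  (* [Rmax 0] does not increase distances and lands in the half-line, so it turns full
     neighbourhoods into relative ones. *)
  - intros P [eps HP]. exists eps. intros y Hy. apply HP; [|apply Rmax_l].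
    apply ball_Rabs in Hy. apply Rabs_ball.
    eapply Rle_lt_trans; [|exact Hy].
    unfold Rmax; destruct (Rle_dec 0 y), (Rle_dec 0 x); unfold Rabs; repeat destruct Rcase_abs; lra.
  - apply Hg, Rmax_l.
Qed.

Lemma deriv_on_nonneg_part pr g g' x : real_part_like pr -> deriv_on_nonneg g g' -> 0 < x ->
  is_derive (fun y => pr (g y)) x (pr (g' x)).
Proof.
  intros [Hpr [_ Hdiv]] Hg Hx. apply is_derive_Reals. intros eps Heps.
  pose proof (Hg x (Rlt_le _ _ Hx)) as H.
  pose proof (filterlim_comp _ _ _ _ pr _ _ _ H (Hpr (g' x))) as H1.
  destruct (proj1 (filterlim_locally _ _) H1 (mkposreal _ Heps)) as [d Hd].
  (* An increment smaller than [x] keeps [x + h] in the half-line, where the difference quotient is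
     controlled. *)
  assert (Hm : 0 < Rmin d x) by (apply Rmin_glb_lt; [apply cond_pos|auto]).
  exists (mkposreal _ Hm). intros h Hh0 Hh. simpl in Hh.
  pose proof (Rmin_l d x). pose proof (Rmin_r d x).
  specialize (Hd (x + h)).
  assert (Hball : ball x d (x + h)). { apply Rabs_ball. replace (x + h - x) with h by ring. lra. }
  assert (Hin : 0 <= x + h /\ x + h <> x).
  { split; [|lra]. destruct (Rabs_def2 h (Rmin d x) Hh). lra. }
  specialize (Hd Hball Hin). apply ball_Rabs in Hd. simpl in Hd.
  rewrite Hdiv in Hd by lra. replace (x + h - x) with h in Hd by ring. exact Hd.
Qed.

Lemma class_M_part pr alpha k f sigma : real_part_like pr -> (2 <= k)%nat ->
  class_M alpha k f -> 1 < sigma < alpha ->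
  smooth_dom (fun u => pr (f (exp u)) * exp (sigma * u)).
Proof.
  intros Hpr Hk (D & HD0 & HDc & HDd & HDb) Hs.
  assert (B : forall j, (j <= 2)%nat -> strip_bdd alpha (INR j) (fun x => pr (D j x))).
  { intros j Hj. destruct (HDb j ltac:(lia)) as (c & M & HM & Hb).
    apply (strip_bdd_intro alpha (INR j) _ M c).
    - apply pos_INR.
    - apply (cont_on_nonneg_part pr (D j) Hpr). apply HDc; lia.
    - intros x Hx. eapply Rle_trans; [apply Hpr|]. apply Hb; auto. }
  assert (Ef : forall u, pr (D O (exp u)) * exp (sigma * u) = pr (f (exp u)) * exp (sigma * u)).
  { intros u. rewrite HD0; auto. left; apply exp_pos. }
  apply (smooth_dom_ext _ _ Ef).
  apply (strip_smooth alpha sigma (fun x => pr (D O x)) (fun x => pr (D 1%nat x)) (fun x => pr (D 2%nat x))); auto.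
  - apply (B 0%nat); lia.
  - apply (B 1%nat); lia.
  - apply (B 2%nat); lia.
  - intros x Hx. apply (deriv_on_nonneg_part pr); [auto|apply HDd; lia|auto].
  - intros x Hx. apply (deriv_on_nonneg_part pr (D 1%nat)); [auto|apply HDd; lia|auto].
Qed.

Lemma class_M_smooth alpha k f sigma : (2 <= k)%nat -> class_M alpha k f -> 1 < sigma < alpha ->
  Csmooth (fun u => (RtoC (exp (sigma * u)) * f (exp u))%C).
Proof.
  intros Hk Hf Hs.
  split.
  - apply (smooth_dom_ext (fun u => Re (f (exp u)) * exp (sigma * u))).
    + intros u. unfold Re, Cmult, RtoC; simpl. ring.
    + apply (class_M_part Re alpha k); auto using real_part_like_Re.
  - apply (smooth_dom_ext (fun u => Im (f (exp u)) * exp (sigma * u))).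
    + intros u. unfold Im, Cmult, RtoC; simpl. ring.
    + apply (class_M_part Im alpha k); auto using real_part_like_Im.
Qed.

(** * Mellin transforms in the logarithmic variable *)

Lemma cpow_exp u s : cpow (exp u) s = (RtoC (exp (Re s * u)) * cis (Im s * u))%C.
Proof.
  unfold cpow, Rpower, cis, Cmult, RtoC; simpl. rewrite ln_exp. f_equal; ring.
Qed.

Lemma cauchy_dom_exp_subst K h : cauchy_dom K (fun u => h (exp u) * exp u) ->
  is_RInt_gen h (at_right 0) pinf (Jint (fun u => h (exp u) * exp u)).
Proof.
  intros H. apply Jint_exp_subst; [|apply (cauchy_dom_is K); auto].
  intros x Hx.
  (* Continuity of [h] at positive points is recovered by dividing out [exp] and then composing with
     [ln]. *)
  assert (c1 : forall u, continuous (fun v => h (exp v)) u).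
  { intros u. apply (continuous_ext (fun v => h (exp v) * exp v * exp (- v))).
    - intros v. rewrite Rmult_assoc, <- exp_plus, Rplus_opp_r, exp_0. apply Rmult_1_r.
    - apply Rcontinuous_mult; [apply H|]. cont_by_derive. }
  apply (continuous_ext_loc h (fun y => h (exp (ln y)))).
  - exists (mkposreal _ Hx). intros y Hy. apply ball_Rabs, Rabs_def2 in Hy. simpl in Hy.
    rewrite exp_ln by lra. auto.
  - apply (continuous_comp ln (fun v => h (exp v))); auto.
    cont_by_derive.
Qed.

Lemma at_right_filter x : Filter (at_right x).
Proof. apply within_filter, locally_filter. Qed.

Lemma Cdom_exp_subst K h : Cdom K (fun u => (h (exp u) * RtoC (exp u))%C) ->
  is_CInt_gen h (at_right 0) pinf (CJ (fun u => (h (exp u) * RtoC (exp u))%C)) /\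
  ex_RInt_gen (fun x => Cmod (h x)) (at_right 0) pinf.
Proof.
  intros H. split.
  - destruct H as [H1 H2].
    assert (E1 : forall u, Re (h (exp u) * RtoC (exp u))%C = Re (h (exp u)) * exp u).
    { intros u. unfold Re, Cmult, RtoC; simpl. ring. }
    assert (E2 : forall u, Im (h (exp u) * RtoC (exp u))%C = Im (h (exp u)) * exp u).
    { intros u. unfold Im, Cmult, RtoC; simpl. ring. }
    apply is_CInt_gen_pair; try apply Rbar_locally_filter; try apply at_right_filter.
    + rewrite (Jint_ext _ _ _ H1 E1). apply (cauchy_dom_exp_subst K (fun x => Re (h x))).
      apply (cauchy_dom_ext K _ _ E1 H1).
    + rewrite (Jint_ext _ _ _ H2 E2). apply (cauchy_dom_exp_subst K (fun x => Im (h x))).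
      apply (cauchy_dom_ext K _ _ E2 H2).
  - eexists. apply (cauchy_dom_exp_subst (K + K) (fun x => Cmod (h x))).
    apply (cauchy_dom_ext _ (fun u => Cmod (h (exp u) * RtoC (exp u))%C)); [|apply Cdom_Cmod; auto].
    intros u. rewrite Cmod_mult, Cmod_R, Rabs_right; auto. left; apply exp_pos.
Qed.

(** The Jacobian [exp u] absorbs the [- 1] of the exponent [s - 1]. *)
Lemma mellin_kernel f s u :
  (f (exp u) * cpow (exp u) (s - 1) * RtoC (exp u))%C =
  ((RtoC (exp (Re s * u)) * f (exp u)) * cis (Im s * u))%C.
Proof.
  rewrite cpow_exp.
  replace (Re (s - 1)%C * u) with (Re s * u + - u) by (unfold Re; simpl; ring).
  replace (Im (s - 1)%C * u) with (Im s * u) by (unfold Im; simpl; ring).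
  rewrite exp_plus, RtoC_mult, exp_Ropp, RtoC_inv by (apply Rgt_not_eq, exp_pos).
  field. intros H. apply RtoC_inj in H. pose proof (exp_pos u). lra.
Qed.

Lemma mellin_Ftr f s : Csmooth (fun u => (RtoC (exp (Re s * u)) * f (exp u))%C) ->
  mellin f s = Ftr (fun u => (RtoC (exp (Re s * u)) * f (exp u))%C) (Im s).
Proof.
  intros [(_ & _ & L & _ & _ & H1 & _) (_ & _ & L' & _ & _ & H2 & _)].
  pose proof (Cdom_cis L L' _ (Im s) H1 H2) as D.
  pose proof (Cdom_ext _ _ _ (fun u => eq_sym (mellin_kernel f s u)) D) as D'.
  destruct (Cdom_exp_subst _ (fun x => (f x * cpow x (s - 1))%C) D') as [I _].
  unfold Ftr. rewrite <- (CJ_ext _ _ _ D' (mellin_kernel f s)).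
  exact (@is_RInt_gen_unique CR (at_right 0) pinf
    (Proper_StrongProper _ (at_right_proper_filter 0))
    (Proper_StrongProper _ (Rbar_locally_filter p_infty)) _ _ I).
Qed.

(** * Summation over n *)

Definition lnS (n : nat) : R := ln (INR (S n)).

Lemma exp_lnS n : exp (lnS n) = INR (S n).
Proof. apply exp_ln, lt_0_INR. lia. Qed.

Lemma lnS_nonneg n : 0 <= lnS n.
Proof.
  unfold lnS. rewrite <- ln_1. destruct n as [|n]; [right; auto|].
  left. apply ln_increasing; [lra|]. rewrite S_INR. pose proof (lt_0_INR (S n) ltac:(lia)). lra.
Qed.

Lemma cpow_exp_opp u s :
  cpow (exp u) (- s) = (RtoC (exp (- Re s * u)) * cis (- Im s * u))%C.
Proof. apply cpow_exp. Qed.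

Lemma dterm_exp phi s n :
  dterm phi s n = (phi (S n) * RtoC (exp (- Re s * lnS n)) * cis (- Im s * lnS n))%C.
Proof. unfold dterm. rewrite <- exp_lnS, cpow_exp_opp. ring. Qed.

Lemma Cmod_exp_real x : Cmod (RtoC (exp x)) = exp x.
Proof. rewrite Cmod_R. apply Rabs_right. left; apply exp_pos. Qed.

Lemma Cmod_dterm phi s n : Cmod (dterm phi s n) = Cmod (phi (S n)) * exp (- Re s * lnS n).
Proof. rewrite dterm_exp, !Cmod_mult, Cmod_cis, Cmod_exp_real. ring. Qed.

(** With [x = exp y], Fourier inversion at the point [ln n + y] returns [f (n x)] times
    [exp (sigma * (ln n + y))], which the modulus of [(n x) ^ (- s)] cancels. *)
Lemma CJ_inversion_sum alpha k f phi sigma y : (2 <= k)%nat -> class_M alpha k f ->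
  1 < sigma < alpha ->
  (forall s : C, 1 < Re s -> ex_series (fun n => Cmod (dterm phi s n))) ->
  exists K,
    Cdom K (fun t => (Dirichlet phi (sigma, t) * mellin f (sigma, t) * cpow (exp y) (- (sigma, t)))%C) /\
    CJ (fun t => (Dirichlet phi (sigma, t) * mellin f (sigma, t) * cpow (exp y) (- (sigma, t)))%C) =
      CSeries (fun n => (RtoC (2 * PI) * (phi (S n) * f (INR (S n) * exp y)%R))%C).
Proof.
  intros Hk Hf Hs Hphi.
  pose proof (class_M_smooth alpha k f sigma Hk Hf Hs) as HP.
  set (P := fun u => (RtoC (exp (sigma * u)) * f (exp u))%C) in *.
  destruct (Ftr_dom P HP) as [K [HF _]].
  (* Moduli go into [c n] and phases into [cis]. A phase leaves the size of [Ftr P] unchanged, so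
     the majorant of the [n]-th term is [Cmod (c n)] times a fixed constant. *)
  set (c := fun n => (phi (S n) * RtoC (exp (- sigma * (lnS n + y))))%C).
  set (h := fun n t => (c n * (cis (- t * (lnS n + y)) * Ftr P t))%C).
  set (M := fun n => Cmod (c n) * (K + K) + Cmod (c n) * (K + K)).
  assert (Hh : forall n, Cdom (M n) (h n)).
  { intros n. exact (Cdom_scal _ (c n) _ (Cdom_twist K (lnS n + y) _ HF)). }
  assert (HM : ex_series M).
  { apply (ex_series_ext (fun n => (4 * K * exp (- sigma * y)) * Cmod (dterm phi (sigma, 0) n))).
    - intros n. rewrite Cmod_dterm. unfold M, c. rewrite Cmod_mult, Cmod_exp_real.
      replace (- sigma * (lnS n + y)) with (- sigma * lnS n + - sigma * y) by ring.
      rewrite exp_plus. unfold Re; simpl. ring.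
    - apply (Rex_series_scal (4 * K * exp (- sigma * y))). apply Hphi. simpl. lra. }
  destruct (Cdom_series h M Hh HM) as [D E].
  assert (EE : forall t, CSeries (fun n => h n t) =
    (Dirichlet phi (sigma, t) * mellin f (sigma, t) * cpow (exp y) (- (sigma, t)))%C).
  { intros t. rewrite (mellin_Ftr f (sigma, t) HP).
    change (Ftr (fun u => (RtoC (exp (Re (sigma, t) * u)) * f (exp u))%C) (Im (sigma, t))) with (Ftr P t).
    unfold Dirichlet.
    rewrite (CSeries_ext _ (fun n => ((Ftr P t * cpow (exp y) (- (sigma, t))) * dterm phi (sigma, t) n)%C)).
    - rewrite CSeries_scal by (apply Hphi; simpl; lra). ring.
    - intros n. unfold h, c. rewrite dterm_exp, cpow_exp_opp. simpl Re; simpl Im.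
      replace (- sigma * (lnS n + y)) with (- sigma * lnS n + - sigma * y) by ring.
      replace (- t * (lnS n + y)) with (- t * lnS n + - t * y) by ring.
      rewrite exp_plus, cis_plus, RtoC_mult. ring. }
  exists (Series M). split; [apply (Cdom_ext _ _ _ EE D)|].
  rewrite <- (CJ_ext _ _ _ D EE), E. apply CSeries_ext. intros n.
  unfold h. rewrite (CJ_scal _ _ _ (Cdom_twist K (lnS n + y) _ HF)), Ftr_inversion by auto.
  unfold c, P. rewrite exp_plus, exp_lnS.
  replace (- sigma * (lnS n + y)) with (- (sigma * (lnS n + y))) by ring.
  rewrite exp_Ropp, RtoC_inv by (apply Rgt_not_eq, exp_pos).
  field. intros H. apply RtoC_inj in H. pose proof (exp_pos (sigma * (lnS n + y))). lra.
Qed.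

(** Boundedness of [P] means that [f (n x)] is at most a constant times [(n x) ^ (- sigma)], so the
    Dirichlet series at [sigma] is a majorant. *)
Lemma ex_series_phi_f alpha k f phi sigma y : (2 <= k)%nat -> class_M alpha k f ->
  1 < sigma < alpha ->
  (forall s : C, 1 < Re s -> ex_series (fun n => Cmod (dterm phi s n))) ->
  ex_series (fun n => Cmod (phi (S n) * f (INR (S n) * exp y)%R)%C).
Proof.
  intros Hk Hf Hs Hphi.
  pose proof (class_M_smooth alpha k f sigma Hk Hf Hs) as HP.
  set (P := fun u => (RtoC (exp (sigma * u)) * f (exp u))%C) in *.
  destruct HP as [(_ & _ & L & _ & _ & H1 & _) (_ & _ & L' & _ & _ & H2 & _)].
  assert (B : exists B, forall u, Cmod (P u) <= B).
  { exists (L + L' + (L + L')). intros u.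
    assert (D : Cdom (L + L') P).
    { apply (Cdom_ext _ (fun u => (P u * cis (0 * u))%C)).
      - intros v. rewrite Rmult_0_l, cis_0. ring.
      - apply Cdom_cis; auto. }
    eapply Rle_trans; [apply Rle_abs|]. apply (cauchy_dom_bounded _ _ (Cdom_Cmod _ _ D)). }
  destruct B as [B HB].
  apply (ex_series_le (V := R_CompleteNormedModule) _
    (fun n => (B * exp (- sigma * y)) * Cmod (dterm phi (sigma, 0) n))).
  - intros n. change (Rabs (Cmod (phi (S n) * f (INR (S n) * exp y)%R)%C) <=
      B * exp (- sigma * y) * Cmod (dterm phi (sigma, 0) n)).
    rewrite Rabs_right by apply Rle_ge, Cmod_ge_0.
    rewrite Cmod_dterm, Cmod_mult. simpl Re.
    specialize (HB (lnS n + y)). unfold P in HB. rewrite Cmod_mult, Cmod_exp_real in HB.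
    rewrite (exp_plus (lnS n) y), exp_lnS in HB.
    pose proof (Cmod_ge_0 (phi (S n))).
    replace (B * exp (- sigma * y) * (Cmod (phi (S n)) * exp (- sigma * lnS n)))
      with (Cmod (phi (S n)) * (B * / exp (sigma * (lnS n + y)))).
    + apply Rmult_le_compat_l; auto. pose proof (exp_pos (sigma * (lnS n + y))) as He.
      apply (proj1 (Rle_div_r _ _ _ He)). rewrite Rmult_comm. exact HB.
    + rewrite <- exp_Ropp. replace (- (sigma * (lnS n + y))) with (- sigma * lnS n + - sigma * y) by ring.
      rewrite exp_plus. ring.
  - apply (Rex_series_scal (B * exp (- sigma * y))). apply Hphi. simpl; lra.
Qed.

(** In the inversion a translation by [ln n] was only a phase; here the translates of [P] themselves
    must be dominated in [u], and [exp_weight] trades the resulting weight for [n ^ d]. *)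
Lemma mellin_sum alpha k f phi s : (2 <= k)%nat -> class_M alpha k f ->
  1 < Re s < alpha ->
  (forall s : C, 1 < Re s -> ex_series (fun n => Cmod (dterm phi s n))) ->
  exists K,
    Cdom K (fun u => (phisum phi f (exp u) * cpow (exp u) (s - 1) * RtoC (exp u))%C) /\
    CJ (fun u => (phisum phi f (exp u) * cpow (exp u) (s - 1) * RtoC (exp u))%C) =
      (Dirichlet phi s * mellin f s)%C.
Proof.
  intros Hk Hf Hs Hphi.
  pose proof (class_M_smooth alpha k f (Re s) Hk Hf Hs) as HP.
  rewrite (mellin_Ftr f s HP).
  set (P := fun u => (RtoC (exp (Re s * u)) * f (exp u))%C) in *.
  destruct HP as [HP1 HP2].
  pose proof HP1 as (_ & _ & L & _ & _ & H1 & _). pose proof HP2 as (_ & _ & L' & _ & _ & H2 & _).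
  (* Half the distance to 1, so that [Re s - d] still exceeds 1. *)
  set (d := (Re s - 1) / 2). assert (Hd : 0 < d) by (unfold d; lra).
  destruct (exp_weight d Hd) as [W [HW0 HW]].
  set (c := fun n => (phi (S n) * RtoC (exp (- Re s * lnS n)))%C).
  set (h := fun n u => (c n * (P (u + lnS n)%R * cis (Im s * u)))%C).
  set (w := fun n => 2 * ((1 + Rabs (lnS n)) * (1 + lnS n ^ 2))).
  assert (Dn : forall n, Cdom (w n * L + w n * L') (fun u => (P (u + lnS n)%R * cis (Im s * u))%C)).
  { intros n. apply (Cdom_cis _ _ (fun u => P (u + lnS n))).
    - apply (moment_dom_shift L (fun u => Re (P u))); auto.
    - apply (moment_dom_shift L' (fun u => Im (P u))); auto. }
  (* Of the 4, one factor 2 is that of [w n] and the other comes from the product with [c n]; [W]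
     and the lowered exponent bound the rest of [w n]. *)
  set (M := fun n => 4 * (L + L') * W * Cmod (dterm phi (Re s - d, 0) n)).
  pose proof (moment_dom_nonneg _ _ H1) as HL. pose proof (moment_dom_nonneg _ _ H2) as HL'.
  assert (Hh : forall n, Cdom (M n) (h n)).
  { intros n. pose proof (Cdom_scal _ (c n) _ (Dn n)) as [A1 A2].
    assert (HMn : Cmod (c n) * (w n * L + w n * L') + Cmod (c n) * (w n * L + w n * L') <= M n).
    { unfold M, c, w. rewrite Cmod_mult, Cmod_exp_real, Cmod_dterm. simpl Re.
      specialize (HW (lnS n)). rewrite (Rabs_right (lnS n)) in * by (apply Rle_ge, lnS_nonneg).
      set (v := lnS n) in *. set (m := Cmod (phi (S n))). assert (Hm : 0 <= m) by apply Cmod_ge_0.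
      replace (- (Re s - d) * v) with (- Re s * v + d * v) by ring.
      replace (- d * v) with (- (d * v)) in HW by ring.
      rewrite exp_Ropp in HW. apply (proj1 (Rle_div_l _ _ _ (exp_pos (d * v)))) in HW.
      rewrite exp_plus. pose proof (exp_pos (- Re s * v)).
      set (X := 4 * (L + L') * m * exp (- Re s * v)).
      assert (HX : 0 <= X) by (unfold X; repeat apply Rmult_le_pos; lra).
      apply Rle_trans with (X * ((1 + v) * (1 + v ^ 2))); [right; unfold X; ring|].
      apply Rle_trans with (X * (W * exp (d * v))); [|right; unfold X; ring].
      apply Rmult_le_compat_l; auto. }
    split; apply (cauchy_dom_weaken _ _ _ HMn); auto. }
  assert (HM : ex_series M).
  { apply (Rex_series_scal (4 * (L + L') * W)). apply Hphi. simpl. unfold d; lra. }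
  destruct (Cdom_series h M Hh HM) as [D E].
  assert (EE : forall u, CSeries (fun n => h n u) =
    (phisum phi f (exp u) * cpow (exp u) (s - 1) * RtoC (exp u))%C).
  { intros u. rewrite (mellin_kernel (phisum phi f) s u).
    set (z := (RtoC (exp (Re s * u)) * cis (Im s * u))%C).
    rewrite (CSeries_ext _ (fun n => (z * (phi (S n) * f (INR (S n) * exp u)%R))%C)).
    - rewrite CSeries_scal.
      + unfold phisum, z. ring.
      + apply (ex_series_phi_f alpha k f phi (Re s)); auto.
    - intros n. unfold h, c, P, z. rewrite (exp_plus u (lnS n)), exp_lnS, (Rmult_comm (exp u)).
      replace (Re s * (u + lnS n)) with (Re s * u + Re s * lnS n) by ring.
      replace (- Re s * lnS n) with (- (Re s * lnS n)) by ring.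
      rewrite exp_plus, RtoC_mult, exp_Ropp, RtoC_inv by (apply Rgt_not_eq, exp_pos).
      field. intros H. apply RtoC_inj in H. pose proof (exp_pos (Re s * lnS n)). lra. }
  exists (Series M). split; [apply (Cdom_ext _ _ _ EE D)|].
  rewrite <- (CJ_ext _ _ _ D EE), E.
  unfold Dirichlet.
  rewrite (CSeries_ext _ (fun n => (Ftr P (Im s) * dterm phi s n)%C)).
  - rewrite CSeries_scal by (apply Hphi; lra). ring.
  - intros n. unfold h. rewrite (CJ_scal _ _ _ (Dn n)).
    change (CJ (fun u => (P (u + lnS n)%R * cis (Im s * u))%C)) with (Ftr (fun u => P (u + lnS n)) (Im s)).
    rewrite (Ftr_shift P (lnS n) (Im s) (conj HP1 HP2)), dterm_exp. unfold c. ring.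
Qed.

Theorem theorem2 (alpha : R) (k : nat) (f : R -> C) (phi : nat -> C) :
  1 < alpha -> (2 <= k)%nat -> class_M alpha k f ->
  (forall s : C, 1 < Re s -> ex_series (fun n => Cmod (dterm phi s n))) ->
  (forall sigma : R, 1 < sigma < alpha ->
     (* Phi f^* is in L_1 on the line Re s = sigma *)
     ex_RInt_gen
       (fun t => Cmod (Dirichlet phi (sigma, t) * mellin f (sigma, t))%C)
       (Rbar_locally m_infty) (Rbar_locally p_infty) /\
     (forall x : R, 0 < x ->
        ex_series (fun n => (phi (S n) * f (INR (S n) * x)%R)%C) /\
        (* int_{sigma-i oo}^{sigma+i oo} Phi(s) f^*(s) x^{-s} ds, s = sigma+it, ds = i dt *)
        is_CInt_gen
          (fun t => (Dirichlet phi (sigma, t) * mellin f (sigma, t)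
                     * cpow x (- (sigma, t)) * Ci)%C)
          (Rbar_locally m_infty) (Rbar_locally p_infty)
          (2 * PI * Ci * phisum phi f x)%C)) /\
  (forall s : C, 1 < Re s < alpha ->
     ex_RInt_gen (fun x => Cmod (phisum phi f x * cpow x (s - 1))%C)
       (at_right 0) (Rbar_locally p_infty) /\
     is_CInt_gen (fun x => (phisum phi f x * cpow x (s - 1))%C)
       (at_right 0) (Rbar_locally p_infty)
       (Dirichlet phi s * mellin f s)%C).
Proof.
  intros _ Hk Hf Hphi. split.
  - intros sigma Hs. split.
    (* Taking [y = 0], that is [x = 1], makes [x ^ (- s)] equal to 1 and leaves the bare product. *)
    + destruct (CJ_inversion_sum alpha k f phi sigma 0 Hk Hf Hs Hphi) as [K [D _]].
      exists (Jint (fun t => Cmod (Dirichlet phi (sigma, t) * mellin f (sigma, t))%C)).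
      apply (cauchy_dom_is (K + K)).
      eapply cauchy_dom_ext; [|apply (Cdom_Cmod _ _ D)].
      intros t. simpl. rewrite cpow_exp_opp, !Rmult_0_r, exp_0, cis_0. f_equal. ring.
    + intros x Hx.
      pose proof (ex_series_phi_f alpha k f phi sigma (ln x) Hk Hf Hs Hphi) as Hex.
      destruct (CJ_inversion_sum alpha k f phi sigma (ln x) Hk Hf Hs Hphi) as [K [D E]].
      rewrite exp_ln in * by auto. split.
      * apply (ex_series_le (K := C_AbsRing) (V := C_CompleteNormedModule) _ _ (fun n => Rle_refl _) Hex).
      * rewrite (CSeries_scal _ _ Hex) in E.
        set (G := fun t => (Dirichlet phi (sigma, t) * mellin f (sigma, t) * cpow x (- (sigma, t)))%C) in *.
        assert (EG : forall t, (Ci * G t)%C = (G t * Ci)%C) by (intros; ring).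
        pose proof (Cdom_ext _ _ _ EG (Cdom_scal _ Ci _ D)) as D'.
        pose proof (Cdom_is _ _ D') as I.
        rewrite <- (CJ_ext _ _ _ (Cdom_scal _ Ci _ D) EG), (CJ_scal _ _ _ D), E in I.
        replace (2 * PI * Ci * phisum phi f x)%C with
          (Ci * (RtoC (2 * PI) * CSeries (fun n => (phi (S n) * f (INR (S n) * x)%R)%C)))%C; [exact I|].
        rewrite RtoC_mult. unfold phisum. ring.
  - intros s Hs.
    destruct (mellin_sum alpha k f phi s Hk Hf Hs Hphi) as [K [D E]].
    destruct (Cdom_exp_subst K (fun x => (phisum phi f x * cpow x (s - 1))%C) D) as [I1 I2].
    rewrite E in I1. auto.
Qed.
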